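(* Let $\mathcal H$ be a finite-dimensional Hilbert space and $\mathcal A\subset\mathcal O(\mathcal H)$ a set of observables. The following are equivalent: (1) $\mathcal A$ does not allow for a proof of contextuality of quantum theory; (2) $(\mathcal S(\mathcal H),\mathcal A,\mathcal A)$ is broadcastable; (3) there is a single POVM $\{G_\lambda\}_\lambda$ with $\|G_\lambda\|=1$ for all $\lambda$ such that every $\{A_k\}_k\in\mathcal A$ is a classical post-processing of $\{G_\lambda\}_\lambda$; (4) there is a single repeatable POVM such that every $\{A_k\}_k\in\mathcal A$ is a classical post-processing of it.
   Context: $\mathcal S(\mathcal H)$ is the set of states; $\mathcal O(\mathcal H)$ the set of POVMs (finitely many positive operators summing to $I$). A set of observables $\mathcal A$ does not allow for a proof of contextuality of quantum theory if there exist a POVM $\{G_\lambda\}_\lambda$ and states $\{\sigma_\lambda\}_\lambda$ (finite index set) with $\mathrm{tr}[\rho A_k]=\sum_\lambda\mathrm{tr}[\rho G_\lambda]\mathrm{tr}[\sigma_\lambda A_k]$ for all states $\rho$, all $\{A_k\}\in\mathcal A$ and all $k$; equivalently $A_k=\sum_\lambda\mathrm{tr}[\sigma_\lambda A_k]G_\lambda$. $(\mathcal T,\mathcal A,\mathcal B)$ is broadcastable if there is a CPTP map $\Lambda:\mathcal L(\mathcal H)\to\mathcal L(\mathcal H\otimes\mathcal H)$ with $\mathrm{tr}[A_k\mathrm{tr}_2\Lambda(\rho)]=\mathrm{tr}[A_k\rho]$ and $\mathrm{tr}[B_k\mathrm{tr}_1\Lambda(\rho)]=\mathrm{tr}[B_k\rho]$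 for all $\{A_k\}\in\mathcal A$, $\{B_k\}\in\mathcal B$, $\rho\in\mathcal T$, $k$. $\|\cdot\|$ is the operator norm. A classical post-processing of $\{G_\lambda\}$ is a POVM $A_k=\sum_\lambda p(k|\lambda)G_\lambda$ with $p(\cdot|\lambda)$ probability distributions. An instrument is a family $\{\mathcal I_k\}$ of completely positive trace-non-increasing maps with $\sum_k\mathcal I_k$ trace preserving; it implements $\{A_k\}$ if $\mathcal I_k^*(I)=A_k$ (Heisenberg picture). $\{A_k\}$ is repeatable if some instrument implementing it satisfies $\mathcal I_k^*(A_k)=A_k$ for all $k$. *)

(* Defs.v *)
(* Quantum-information notions on a finite-dimensional
   Hilbert space H = C^n, with C a numClosedFieldType (e.g. the complex
   numbers R[i] over a real closed field R).  Operators on H are n x n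
   matrices; H (x) H is C^(n*n), indexed by mxtens_index (i, j). *)
From HB Require Import structures.
From mathcomp Require Import all_boot all_order all_algebra.
From mathcomp Require Import mxtens.
Set Implicit Arguments.
Unset Strict Implicit.
Unset Printing Implicit Defensive.
Import Order.TTheory GRing.Theory Num.Theory.
Local Open Scope ring_scope.

Section Quantum.
Variable C : numClosedFieldType.

Definition adj m p (A : 'M[C]_(m, p)) : 'M[C]_(p, m) := map_mx Num.conj A^T.

Definition vnorm n (v : 'cV[C]_n) : C := sqrtC ((adj v *m v) 0 0).

Definition opnorm_is n (X : 'M[C]_n) (c : C) : Prop :=
  (forall v : 'cV[C]_n, vnorm v = 1 -> vnorm (X *m v) <= c) /\
  (forall c' : C, (forall v : 'cV[C]_n, vnorm v = 1 -> vnorm (X *m v) <= c') ->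
     c <= c').

Definition psd n (A : 'M[C]_n) : Prop :=
  forall v : 'cV[C]_n, 0 <= (adj v *m A *m v) 0 0.

Definition is_state n (rho : 'M[C]_n) : Prop := psd rho /\ \tr rho = 1.

(* O(H): a POVM is a finite list of positive operators summing to I;
   the outcome k of {A_k} is the position k in the list. *)
Definition is_povm n (E : seq 'M[C]_n) : Prop :=
  (forall k : 'I_(size E), psd E`_k) /\ \sum_(k < size E) E`_k = 1%:M.

Definition post_processing n (A G : seq 'M[C]_n) : Prop :=
  exists p : 'I_(size A) -> 'I_(size G) -> C,
    (forall (k : 'I_(size A)) (l : 'I_(size G)), 0 <= p k l) /\
    (forall l : 'I_(size G), \sum_(k < size A) p k l = 1) /\
    (forall k : 'I_(size A), A`_k = \sum_(l < size G) p k l *: G`_l).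

Definition no_contextuality_proof n (calA : seq 'M[C]_n -> Prop) : Prop :=
  exists (G : seq 'M[C]_n) (sigma : 'I_(size G) -> 'M[C]_n),
    is_povm G /\ (forall l, is_state (sigma l)) /\
    forall A, calA A -> forall (k : 'I_(size A)) (rho : 'M[C]_n), is_state rho ->
      \tr (rho *m A`_k) =
        \sum_(l < size G) \tr (rho *m G`_l) * \tr (sigma l *m A`_k).

(* id_m (x) f, for f : L(C^n) -> L(C^p), acting on L(C^m (x) C^n):
   sum_{a,b} |a><b| (x) X_{ab}  |->  sum_{a,b} |a><b| (x) f(X_{ab}) *)
Definition ampl m n p (f : 'M[C]_n -> 'M[C]_p) (X : 'M[C]_(m * n)) :
  'M[C]_(m * p) :=
  \sum_(a < m) \sum_(b < m)
    tensmx (delta_mx a b : 'M[C]_m)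
      (f (\matrix_(i, j) X (mxtens_index (a, i)) (mxtens_index (b, j)))).

Definition completely_positive n p (f : 'M[C]_n -> 'M[C]_p) : Prop :=
  forall (m : nat) (X : 'M[C]_(m * n)), psd X -> psd (ampl f X).

Definition trace_preserving n p (f : 'M[C]_n -> 'M[C]_p) : Prop :=
  forall X : 'M[C]_n, \tr (f X) = \tr X.

Definition trace_nonincreasing n p (f : 'M[C]_n -> 'M[C]_p) : Prop :=
  forall X : 'M[C]_n, psd X -> \tr (f X) <= \tr X.

Definition ptrace2 n (Y : 'M[C]_(n * n)) : 'M[C]_n :=
  \matrix_(i, j) \sum_(k < n) Y (mxtens_index (i, k)) (mxtens_index (j, k)).
Definition ptrace1 n (Y : 'M[C]_(n * n)) : 'M[C]_n :=
  \matrix_(i, j) \sum_(k < n) Y (mxtens_index (k, i)) (mxtens_index (k, j)).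

Definition broadcastable n (T : 'M[C]_n -> Prop)
    (calA calB : seq 'M[C]_n -> Prop) : Prop :=
  exists Lam : {linear 'M[C]_n -> 'M[C]_(n * n)},
    completely_positive Lam /\ trace_preserving Lam /\
    (forall A, calA A -> forall (k : 'I_(size A)) rho, T rho ->
       \tr (A`_k *m ptrace2 (Lam rho)) = \tr (A`_k *m rho)) /\
    (forall B, calB B -> forall (k : 'I_(size B)) rho, T rho ->
       \tr (B`_k *m ptrace1 (Lam rho)) = \tr (B`_k *m rho)).

(* Heisenberg-picture dual of f : L(H) -> L(H), characterised by
   tr (hdual f X * rho) = tr (X * f rho); entrywise
   (hdual f X)_{ij} = tr (X f(|j><i|)). *)
Definition hdual n (f : 'M[C]_n -> 'M[C]_n) (X : 'M[C]_n) : 'M[C]_n :=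
  \matrix_(i, j) \tr (X *m f (delta_mx j i)).

Definition is_instrument n N (I : 'I_N -> {linear 'M[C]_n -> 'M[C]_n}) : Prop :=
  (forall k, completely_positive (I k)) /\
  (forall k, trace_nonincreasing (I k)) /\
  trace_preserving (fun X => \sum_(k < N) I k X).

Definition implements n (A : seq 'M[C]_n)
    (I : 'I_(size A) -> {linear 'M[C]_n -> 'M[C]_n}) : Prop :=
  forall k : 'I_(size A), hdual (I k) 1%:M = A`_k.

Definition repeatable n (A : seq 'M[C]_n) : Prop :=
  exists I : 'I_(size A) -> {linear 'M[C]_n -> 'M[C]_n},
    is_instrument I /\ implements I /\
    forall k : 'I_(size A), hdual (I k) A`_k = A`_k.

End Quantum.

(* Main.v *)
(* From (1), a finite model A_k = sum_l tr (s_l A_k) G_l is a stationarity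
   equation for the stochastic matrix tr (s_l G_m).  Any outcome l with
   tr (s_l G_l) <> 1 can be eliminated as in Gaussian elimination, so the model
   may be assumed sharp: tr (s_l G_l) = 1 for all l.  A sharp model gives (2)
   by rho |-> sum_l tr (rho G_l) (s_l (x) s_l), (3) by eigenvectors in the range
   of s_l, and (4) by rho |-> tr (rho G_l) s_l.

   (2) => (1) must avoid limits, since C need not be complete.  Let theta be
   the average of the duals of the two marginals of the broadcasting channel.
   The eigenspace of a theta-fixed Hermitian X at its least eigenvalue is an
   invariant subspace, so on a minimal invariant subspace V every fixed X is a
   scalar, its value at V, and X is positive as soon as all its values are.
   A maximum principle shows that the space of operators is the sum of the
   fixed operators and the range of 1 - theta, and together with
   dual (X (x) Y) this makes the value functions of the fixed operators closed
   under products.  Hence a family g_i of fixed operators biorthogonal to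
   finitely many points V_j has 0/1 values everywhere: it is a POVM, and
   X = sum_i (value of X at V_i) g_i for every fixed X. *)
Require Import Defs.
From HB Require Import structures.
From mathcomp Require Import all_boot all_order all_algebra.
From mathcomp Require Import mxtens.
From Stdlib Require Import Classical.
Import Order.TTheory GRing.Theory Num.Theory.
Local Open Scope ring_scope.
Set Implicit Arguments.
Unset Strict Implicit.
Unset Printing Implicit Defensive.

(** * Positive matrices *)

Section Psd.
Variable C : numClosedFieldType.
Implicit Types (m n p q r : nat).

Lemma adjK m n (A : 'M[C]_(m, n)) : adj (adj A) = A.
Proof. by apply/matrixP=> i j; rewrite !mxE conjCK. Qed.

Lemma adjD m n (A B : 'M[C]_(m, n)) : adj (A + B) = adj A + adj B.
Proof. by apply/matrixP=> i j; rewrite !mxE rmorphD. Qed.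

Lemma adjN m n (A : 'M[C]_(m, n)) : adj (- A) = - adj A.
Proof. by apply/matrixP=> i j; rewrite !mxE rmorphN. Qed.

Lemma adjZ m n a (A : 'M[C]_(m, n)) : adj (a *: A) = a^* *: adj A.
Proof. by apply/matrixP=> i j; rewrite !mxE rmorphM. Qed.

Lemma adj_mul m n p (A : 'M[C]_(m, n)) (B : 'M[C]_(n, p)) :
  adj (A *m B) = adj B *m adj A.
Proof. by rewrite /adj trmx_mul map_mxM. Qed.

Lemma adj_tens m n p q (A : 'M[C]_(m, n)) (B : 'M[C]_(p, q)) :
  adj (tensmx A B) = tensmx (adj A) (adj B).
Proof. by rewrite /adj trmx_tens map_mxT. Qed.

Lemma adj_scalar n (a : C) : adj a%:M = a^*%:M :> 'M_n.
Proof. by rewrite /adj tr_scalar_mx map_scalar_mx. Qed.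

Lemma adj1 n : adj 1%:M = 1%:M :> 'M[C]_n.
Proof. by rewrite adj_scalar conjC1. Qed.

Lemma tr_adj n (A : 'M[C]_n) : \tr (adj A) = (\tr A)^*.
Proof. by rewrite /mxtrace rmorph_sum; apply: eq_bigr => i _; rewrite !mxE. Qed.

Lemma tr_gram m n (Y : 'M[C]_(m, n)) :
  \tr (adj Y *m Y) = \sum_j \sum_i `|Y i j| ^+ 2.
Proof.
rewrite /mxtrace; apply: eq_bigr => j _; rewrite mxE; apply: eq_bigr => i _.
by rewrite !mxE normCKC.
Qed.

Lemma tr_gram_ge0 m n (Y : 'M[C]_(m, n)) : 0 <= \tr (adj Y *m Y).
Proof. by rewrite tr_gram !sumr_ge0 // => i _; rewrite sumr_ge0 // => *; rewrite exprn_ge0. Qed.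

Lemma tr_gram_eq0 m n (Y : 'M[C]_(m, n)) : \tr (adj Y *m Y) = 0 -> Y = 0.
Proof.
rewrite tr_gram => /eqP; rewrite psumr_eq0 => [/allP Y0|j _]; last first.
  by rewrite sumr_ge0 // => *; rewrite exprn_ge0.
apply/matrixP=> i j; have := Y0 j (mem_index_enum _); rewrite /= psumr_eq0.
  by move=> /allP/(_ i (mem_index_enum _)); rewrite /= sqrf_eq0 normr_eq0 mxE => /eqP.
by move=> *; rewrite exprn_ge0.
Qed.

Lemma quad_tr n (v : 'cV[C]_n) (A : 'M[C]_n) :
  (adj v *m A *m v) 0 0 = \tr (v *m adj v *m A).
Proof. by rewrite -[in RHS]mulmxA [RHS]mxtrace_mulC trace_mx11. Qed.

(* Polarization: test the form on [e_i + e_j] and on [e_i + 'i e_j]. *)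
Lemma quad_eq0 n (A : 'M[C]_n) :
  (forall v : 'cV_n, (adj v *m A *m v) 0 0 = 0) -> A = 0.
Proof.
move=> A0.
have E (i j : 'I_n) : adj (delta_mx i 0 : 'cV[C]_n) *m A *m delta_mx j 0 = (A i j)%:M.
  have -> : adj (delta_mx i 0 : 'cV[C]_n) = delta_mx 0 i.
    by rewrite /adj trmx_delta map_delta_mx.
  by rewrite -rowE -colE; apply/matrixP=> a b; rewrite !mxE !ord1 eqxx mulr1n.
apply/matrixP=> i j; rewrite mxE.
have D k : A k k = 0 by have := A0 (delta_mx k 0); rewrite E mxE eqxx mulr1n.
have H1 := A0 (delta_mx i 0 + delta_mx j 0).
have H2 := A0 (delta_mx i 0 + 'i *: delta_mx j 0).
move: H1 H2; rewrite !adjD adjZ !(mulmxDl, mulmxDr) -!(scalemxAl, scalemxAr).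
rewrite !E !mxE eqxx !mulr1n !D conjCi !(mulr0, addr0, add0r).
move=> /eqP; rewrite addr_eq0 => /eqP ->; rewrite mulrN mulNr opprK -mulr2n => /eqP.
by rewrite mulrn_eq0 mulf_eq0 (negPf (neq0Ci _)) => /eqP.
Qed.

(** [psd] only asks for a nonnegative form. Over a complex field a real-valued form agrees with that
    of its adjoint, and the form determines the matrix. *)
Lemma psd_herm n (A : 'M[C]_n) : psd A -> adj A = A.
Proof.
move=> Ap; apply/eqP; rewrite -subr_eq0; apply/eqP/quad_eq0 => v.
have /CrealP vA := ger0_real (Ap v).
have E : (adj v *m adj A *m v) 0 0 = ((adj v *m A *m v) 0 0)^*.
  have -> : adj v *m adj A *m v = adj (adj v *m A *m v) by rewrite !adj_mul adjK mulmxA.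
  by rewrite [LHS]mxE [in LHS]mxE.
by rewrite mulmxBr mulmxBl [LHS]mxE [X in _ + X]mxE E vA subrr.
Qed.

Lemma herm_spectral n (A : 'M[C]_n) : adj A = A ->
  exists (U : 'M[C]_n) (d : 'rV[C]_n),
    [/\ adj U *m U = 1%:M, U *m adj U = 1%:M, A = U *m diag_mx d *m adj U
      & forall i, d 0 i \is Num.real].
Proof.
move=> hA; have hermA : A \is hermsymmx.
  by apply/is_hermitianmxP; rewrite expr0 scale1r -map_trmx -[LHS]hA /adj map_trmx.
have /orthomx_spectralP eqA := hermitian_normalmx hermA.
have uni := spectral_unitarymx A; have dr := hermitian_spectral_diag_real hermA.
exists (adj (spectralmx A)), (spectral_diag A); rewrite adjK.
have U1 : spectralmx A *m adj (spectralmx A) = 1%:M.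
  by rewrite /adj; apply/unitarymxP.
split=> //; first exact: mulmx1C.
  by rewrite {1}eqA invmx_unitary // -map_trmx.
by move=> i; apply: (mxOverP dr).
Qed.

Lemma psd_gram m n (Y : 'M[C]_(m, n)) : psd (adj Y *m Y).
Proof.
move=> v; have := tr_gram_ge0 (Y *m v).
by rewrite adj_mul trace_mx11 !mulmxA.
Qed.

Lemma quad_diag n (U : 'M[C]_n) (d : 'rV[C]_n) (i : 'I_n) :
  adj U *m U = 1%:M ->
  (adj (col i U) *m (U *m diag_mx d *m adj U) *m col i U) 0 0 = d 0 i.
Proof.
move=> U1; have -> : col i U = U *m delta_mx i 0 by rewrite colE.
rewrite adj_mul -!mulmxA (mulmxA (adj U) U) U1 mul1mx (mulmxA (adj U) U) U1 mul1mx.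
have -> : adj (delta_mx i 0 : 'cV[C]_n) = delta_mx 0 i.
  by rewrite /adj trmx_delta map_delta_mx.
by rewrite -colE -rowE !mxE eqxx mulr1n.
Qed.

(** Square roots of the eigenvalues give the Gram factor through which the trace inequalities below
    are proved. *)
Lemma psdP n (A : 'M[C]_n) : psd A -> exists Y : 'M[C]_n, A = adj Y *m Y.
Proof.
move=> Ap; have [U [d [U1 U2 eqA _]]] := herm_spectral (psd_herm Ap).
have d0 i : 0 <= d 0 i by rewrite -(quad_diag d i U1) -eqA.
exists (diag_mx (\row_i sqrtC (d 0 i)) *m adj U); rewrite adj_mul adjK eqA.
rewrite !mulmxA -[_ *m _ *m diag_mx _]mulmxA; congr (_ *m _ *m _).
rewrite /adj tr_diag_mx map_diag_mx mulmx_diag; congr diag_mx.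
apply/rowP=> i; rewrite !mxE -normCKC ger0_norm ?sqrtC_ge0 //.
by rewrite sqrtCK.
Qed.

Lemma psd_diag n (d : 'rV[C]_n) : (forall i, 0 <= d 0 i) -> psd (diag_mx d).
Proof.
move=> d0; have -> : diag_mx d =
    adj (diag_mx (\row_i sqrtC (d 0 i))) *m diag_mx (\row_i sqrtC (d 0 i)).
  rewrite /adj tr_diag_mx map_diag_mx mulmx_diag; congr diag_mx.
  by apply/rowP=> i; rewrite !mxE -normCKC ger0_norm ?sqrtCK ?sqrtC_ge0.
exact: psd_gram.
Qed.

Lemma psd0 n : psd (0 : 'M[C]_n).
Proof. by move=> v; rewrite mulmx0 mul0mx mxE. Qed.

Lemma psd1 n : psd (1%:M : 'M[C]_n).
Proof. by have := psd_gram (1%:M : 'M[C]_n); rewrite adj1 mul1mx. Qed.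

Lemma psdD n (A B : 'M[C]_n) : psd A -> psd B -> psd (A + B).
Proof. by move=> Ap Bp v; rewrite mulmxDr mulmxDl mxE addr_ge0 ?Ap ?Bp. Qed.

Lemma psdZ n a (A : 'M[C]_n) : 0 <= a -> psd A -> psd (a *: A).
Proof. by move=> a0 Ap v; rewrite -scalemxAr -scalemxAl mxE mulr_ge0 ?Ap. Qed.

Lemma psd_sum n (I : Type) (s : seq I) (P : pred I) (F : I -> 'M[C]_n) :
  (forall i, P i -> psd (F i)) -> psd (\sum_(i <- s | P i) F i).
Proof. by move=> Fp; elim/big_ind: _ => //; [apply: psd0|apply: psdD]. Qed.

Lemma psd_conj m n (A : 'M[C]_m) (Y : 'M[C]_(m, n)) :
  psd A -> psd (adj Y *m A *m Y).
Proof.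
by move=> /psdP[Z ->]; rewrite !mulmxA -adj_mul -mulmxA; apply: psd_gram.
Qed.

Lemma psd_conjV m n (A : 'M[C]_m) (V : 'M[C]_(n, m)) :
  psd A -> psd (V *m A *m adj V).
Proof. by move=> /(psd_conj (adj V)); rewrite adjK. Qed.

Lemma psd_tens m n (A : 'M[C]_m) (B : 'M[C]_n) :
  psd A -> psd B -> psd (tensmx A B).
Proof.
move=> /psdP[Y ->] /psdP[Z ->].
by rewrite -tensmx_mul -adj_tens; apply: psd_gram.
Qed.

Lemma tr_psd_ge0 n (A : 'M[C]_n) : psd A -> 0 <= \tr A.
Proof. by move=> /psdP[Y ->]; apply: tr_gram_ge0. Qed.

Lemma tr_psd_eq0 n (A : 'M[C]_n) : psd A -> \tr A = 0 -> A = 0.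
Proof. by move=> /psdP[Y ->] /tr_gram_eq0 ->; rewrite mulmx0. Qed.

Lemma tr_mul_psd_ge0 n (A B : 'M[C]_n) : psd A -> psd B -> 0 <= \tr (A *m B).
Proof.
move=> Ap /psdP[Z ->]; rewrite mulmxA mxtrace_mulC mulmxA.
exact/tr_psd_ge0/psd_conjV.
Qed.

(** For Gram factors [Y] and [Z], the trace is the squared Hilbert-Schmidt norm of [Y *m adj Z],
    which is a middle factor of the product. *)
Lemma tr_mul_psd_eq0 n (A B : 'M[C]_n) :
  psd A -> psd B -> \tr (A *m B) = 0 -> A *m B = 0.
Proof.
move=> /psdP[Y ->] /psdP[Z ->].
rewrite !mulmxA mxtrace_mulC !mulmxA => tr0.
have /tr_gram_eq0 W0 : \tr (adj (Y *m adj Z) *m (Y *m adj Z)) = 0.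
  by rewrite adj_mul adjK !mulmxA.
by rewrite -(mulmxA _ Y) W0 mulmx0 mul0mx.
Qed.

Lemma psdN_eq0 n (A : 'M[C]_n) : psd A -> psd (- A) -> A = 0.
Proof.
move=> Ap Np; apply: quad_eq0 => v; apply/eqP; rewrite eq_le Ap andbT.
by have := Np v; rewrite mulmxN mulNmx mxE oppr_ge0.
Qed.

Lemma eq_tr_psd n (A B : 'M[C]_n) :
  (forall rho, psd rho -> \tr (rho *m A) = \tr (rho *m B)) -> A = B.
Proof.
move=> AB; apply/eqP; rewrite -subr_eq0; apply/eqP/quad_eq0 => v.
rewrite quad_tr mulmxBr linearB /= AB ?subrr //.
by have := psd_gram (adj v); rewrite adjK.
Qed.

Lemma psd_tr n (A : 'M[C]_n) :
  (forall rho, psd rho -> 0 <= \tr (rho *m A)) -> psd A.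
Proof.
by move=> A0 v; rewrite quad_tr A0 //; have := psd_gram (adj v); rewrite adjK.
Qed.

Lemma psd_normalize n (rho : 'M[C]_n) :
  psd rho -> rho != 0 -> is_state ((\tr rho)^-1 *: rho).
Proof.
move=> rp r0; have t0 : \tr rho != 0 by apply: contra_neq r0; apply: tr_psd_eq0.
by split; [apply: psdZ; rewrite ?invr_ge0 ?tr_psd_ge0|rewrite mxtraceZ mulVf].
Qed.

Lemma eq_tr_state n (A B : 'M[C]_n) :
  (forall rho, is_state rho -> \tr (rho *m A) = \tr (rho *m B)) -> A = B.
Proof.
move=> AB; apply: eq_tr_psd => rho rp.
have [->|r0] := eqVneq rho 0; first by rewrite !mul0mx.
have t0 : \tr rho != 0 by apply: contra_neq r0; apply: tr_psd_eq0.
have := AB _ (psd_normalize rp r0); rewrite -!scalemxAl !mxtraceZ.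
by apply: mulfI; rewrite invr_eq0.
Qed.

End Psd.

(** * Bilinearity, unit and trace of tensor products *)

Section Tensor.
Variable C : numClosedFieldType.

Lemma tensmxDl m n p q (A B : 'M[C]_(m, n)) (D : 'M[C]_(p, q)) :
  tensmx (A + B) D = tensmx A D + tensmx B D.
Proof. by apply/matrixP=> i j; rewrite !mxE mulrDl. Qed.

Lemma tensmxDr m n p q (D : 'M[C]_(m, n)) (A B : 'M[C]_(p, q)) :
  tensmx D (A + B) = tensmx D A + tensmx D B.
Proof. by apply/matrixP=> i j; rewrite !mxE mulrDr. Qed.

Lemma tensmxZl m n p q a (A : 'M[C]_(m, n)) (D : 'M[C]_(p, q)) :
  tensmx (a *: A) D = a *: tensmx A D.
Proof. by apply/matrixP=> i j; rewrite !mxE mulrA. Qed.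

Lemma tensmxZr m n p q a (D : 'M[C]_(m, n)) (A : 'M[C]_(p, q)) :
  tensmx D (a *: A) = a *: tensmx D A.
Proof. by apply/matrixP=> i j; rewrite !mxE mulrCA. Qed.

Lemma tensmx11 m n : tensmx 1%:M 1%:M = 1%:M :> 'M[C]_(m * n).
Proof.
apply/matrixP=> i j; case: (mxtens_indexP i) => a b; case: (mxtens_indexP j) => c d.
rewrite tensmxE !mxE (inj_eq (can_inj (@mxtens_indexK m n))) xpair_eqE.
by case: eqP; case: eqP; rewrite /= ?mulr1 ?mulr0 ?mul0r.
Qed.

Lemma tr_tens m n (A : 'M[C]_m) (B : 'M[C]_n) :
  \tr (tensmx A B) = \tr A * \tr B.
Proof.
rewrite /mxtrace mulr_sum; apply: eq_bigr => k _.
by case: (mxtens_indexP k) => i j; rewrite tensmxE mxtens_indexK.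
Qed.

End Tensor.

(** * Extremal eigenspaces *)

Section Eigen.
Variable C : numClosedFieldType.

Lemma real_seq_min (s : seq C) :
  s != [::] -> {in s, forall x, x \is Num.real} ->
  exists2 x, x \in s & {in s, forall y, x <= y}.
Proof.
elim: s => // a s IH _ sr.
have ar : a \is Num.real by apply: sr; rewrite mem_head.
have [->|s0] := eqVneq s [::].
  by exists a; rewrite ?mem_head // => y; rewrite inE => /eqP ->.
have [x xs xmin] : exists2 x, x \in s & {in s, forall y, x <= y}.
  by apply: IH => // x xs; apply: sr; rewrite inE xs orbT.
have xr : x \is Num.real by apply: sr; rewrite inE xs orbT.
have [ax|/ltW xa] := real_leP ar xr.
  exists a; rewrite ?mem_head // => y; rewrite inE => /orP[/eqP -> //|/xmin].
  exact: le_trans.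
by exists x; rewrite ?inE ?xs ?orbT // => y /[!inE] /orP[/eqP ->|/xmin].
Qed.

(** The columns of [U] are the eigenvectors at the least eigenvalue [m]. The last identity factors
    the complementary projection through [X - m%:M], so that an operator killed by right
    multiplication with [X - m%:M] is supported on the eigenspace. *)
Lemma min_eigenspace n (X : 'M[C]_n) : adj X = X -> (0 < n)%N ->
  exists m s (U : 'M[C]_(n, s)) (P : 'M[C]_n),
    [/\ (0 < s)%N, adj U *m U = 1%:M, psd (X - m%:M), X *m U = m *: U
      & 1%:M - U *m adj U = (X - m%:M) *m P].
Proof.
move=> hX n0; have [U [d [U1 U2 eqX dr]]] := herm_spectral hX.
have [m] : exists2 x, x \in codom (d 0) & {in codom (d 0), forall y, x <= y}.
  apply: real_seq_min; first by rewrite -size_eq0 size_codom card_ord -lt0n.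
  by move=> _ /codomP[i ->].
move=> /codomP[i0 dm] dmin.
pose S := [pred i : 'I_n | d 0 i == m].
have Dm : X - m%:M = U *m diag_mx (\row_i (d 0 i - m)) *m adj U.
  have -> : diag_mx (\row_i (d 0 i - m)) = diag_mx d - m%:M.
    by apply/matrixP=> i j; rewrite !mxE mulrnBl.
  by rewrite mulmxBr mulmxBl -eqX mul_mx_scalar -scalemxAl U2 scalemx1.
pose V := colsub (fun k : 'I_#|S| => enum_val k) U.
(* The inverse of 0 is 0, so [P] is the pseudo-inverse of [X - m%:M]. *)
pose P := U *m diag_mx (\row_i (d 0 i - m)^-1) *m adj U.
exists m, #|S|, V, P; split.
- by apply/card_gt0P; exists i0; rewrite inE dm.
- apply/matrixP=> a b; have := congr1 (fun M : 'M_n => M (enum_val a) (enum_val b)) U1.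
  rewrite !mxE (inj_eq enum_val_inj) => <-.
  by apply: eq_bigr => i _; rewrite !mxE.
- rewrite Dm; apply/psd_conjV/psd_diag => i.
  by rewrite mxE subr_ge0 dmin ?codom_f.
- apply/matrixP=> i k; have XU : X *m U = U *m diag_mx d.
    by rewrite eqX -!mulmxA U1 mulmx1.
  have := congr1 (fun M : 'M_n => M i (enum_val k)) XU; rewrite mul_mx_diag [RHS]mxE.
  have /eqP -> : enum_val k \in S := enum_valP k.
  rewrite [RHS]mulrC !mxE => <-; by apply: eq_bigr => j _; rewrite !mxE.
- rewrite Dm /P -!mulmxA (mulmxA (adj U) U) U1 mul1mx (mulmxA (diag_mx _)) mulmx_diag.
  have -> : V *m adj V = U *m diag_mx (\row_i (i \in S)%:R) *m adj U.
    apply/matrixP=> i j; rewrite mul_mx_diag !mxE.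
    rewrite [RHS](bigID [in S]) /= [X in _ + X]big1 ?addr0 => [|k /negPf nk]; last first.
      by rewrite !mxE nk mulr0 mul0r.
    rewrite [RHS]big_enum_val; apply: eq_bigr => k _.
    by rewrite !mxE enum_valP mulr1.
  rewrite -[X in X - _]U2 -mulmxA -mulmxBr -{1}[adj U]mul1mx -mulmxBl.
  congr (_ *m (_ *m _)); apply/matrixP=> i j; rewrite !mxE -mulrnBl inE /=.
  by case: eqVneq => [->|di]; rewrite ?subrr ?mul0r // subr0 divff // subr_eq0.
Qed.

Lemma isometry_tr n r (V : 'M[C]_(n, r)) t : adj V *m V = 1%:M ->
  \tr (V *m t *m adj V) = \tr t.
Proof. by move=> V1; rewrite -mulmxA mxtrace_mulC -mulmxA V1 mulmx1. Qed.

Lemma tr_compress n r (V : 'M[C]_(n, r)) t X :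
  \tr (V *m t *m adj V *m X) = \tr (t *m (adj V *m X *m V)).
Proof. by rewrite -!mulmxA mxtrace_mulC !mulmxA. Qed.

Lemma tr_mul_ge_scalar r (R B : 'M[C]_r) m :
  psd R -> psd (B - m%:M) -> m * \tr R <= \tr (R *m B).
Proof.
move=> Rp Bp; have := tr_mul_psd_ge0 Rp Bp.
by rewrite mulmxBr linearB /= mul_mx_scalar linearZ /= subr_ge0.
Qed.

Lemma tensmxBl_scalar r (B : 'M[C]_r) m :
  tensmx (B - m%:M) (1%:M : 'M_r) = tensmx B 1%:M - m%:M.
Proof.
have E k : m%:M = m *: 1%:M :> 'M[C]_k by rewrite scalemx1.
by rewrite !E -!scaleNr tensmxDl tensmxZl tensmx11.
Qed.

Lemma tensmxBr_scalar r (B : 'M[C]_r) m :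
  tensmx (1%:M : 'M_r) (B - m%:M) = tensmx 1%:M B - m%:M.
Proof.
have E k : m%:M = m *: 1%:M :> 'M[C]_k by rewrite scalemx1.
by rewrite !E -!scaleNr tensmxDr tensmxZr tensmx11.
Qed.

End Eigen.

(** The hypothesis says that kernel and image meet trivially, so by rank-nullity they span. This
    algebraic splitting does the work of a limit of ergodic means. *)
Lemma ker_im_decomp (F : fieldType) (m n : nat) (f : {linear 'M[F]_(m, n) -> 'M[F]_(m, n)}) :
  (forall W, f (f W) = 0 -> f W = 0) ->
  forall X, exists Z W, f Z = 0 /\ X = Z + f W.
Proof.
move=> ff X; pose A := lin_mx f.
have cap0 : (kermx A :&: A)%MS = 0.
  apply/eqP; rewrite -submx0; apply/rV_subP => v.
  rewrite sub_capmx => /andP[/sub_kermxP vA0 /submxP[w eqv]].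
  move: vA0; rewrite eqv submx0 -[w]vec_mxK !mul_vec_lin.
  move=> /(congr1 vec_mx); rewrite mxvecK linear0 => /ff ->.
  by rewrite linear0.
have full : (1%:M <= kermx A + A)%MS.
  rewrite sub1mx /row_full; have := mxrank_sum_cap (kermx A) A.
  by rewrite cap0 mxrank0 addn0 mxrank_ker subnK ?rank_leq_row // => ->.
have /sub_addsmxP[[u1 u2] eqX] : (mxvec X <= kermx A + A)%MS.
  by apply: submx_trans full; apply: submx1.
exists (vec_mx (u1 *m kermx A)), (vec_mx u2); split.
  apply: (can_inj mxvecK); rewrite -mul_vec_lin vec_mxK -mulmxA mulmx_ker.
  by rewrite mulmx0 linear0.
apply: (can_inj mxvecK); rewrite linearD /= vec_mxK eqX /=.
by rewrite -mul_vec_lin vec_mxK.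
Qed.

(** * Fixed points of a broadcasting channel *)

Section Broadcast.
Variables (C : numClosedFieldType) (n : nat).
Variable Lam : {linear 'M[C]_n -> 'M[C]_(n * n)}.
Hypothesis Lam_pos : forall rho, psd rho -> psd (Lam rho).
Hypothesis Lam_tp : trace_preserving Lam.

Definition dual (Z : 'M[C]_(n * n)) : 'M[C]_n :=
  \matrix_(i, j) \tr (Lam (delta_mx j i) *m Z).

Lemma dualE rho Z : \tr (rho *m dual Z) = \tr (Lam rho *m Z).
Proof.
rewrite {2}[rho]matrix_sum_delta linear_sum mulmx_suml linear_sum.
apply: eq_bigr => i _; rewrite mxE linear_sum mulmx_suml linear_sum.
by apply: eq_bigr => j _; rewrite mxE linearZ /= -scalemxAl linearZ.
Qed.

Lemma dual_is_linear : linear dual.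
Proof.
move=> a Z W; apply: eq_tr_psd => rho _.
by rewrite dualE !(mulmxDr, mulmxDl, linearD, =^~ scalemxAr, linearZ) /= !dualE.
Qed.

HB.instance Definition _ :=
  GRing.isLinear.Build C 'M[C]_(n * n) 'M[C]_n _ dual dual_is_linear.

Lemma dual1 : dual 1%:M = 1%:M.
Proof. by apply: eq_tr_psd => rho _; rewrite dualE !mulmx1 Lam_tp. Qed.

(** It suffices to test against positive [rho], for which [rho] and [Lam rho] are both Hermitian and
    the two traces are conjugated together. *)
Lemma dual_adj Z : dual (adj Z) = adj (dual Z).
Proof.
apply: eq_tr_psd => rho rp; rewrite dualE.
rewrite -[Lam rho](psd_herm (Lam_pos rp)) -adj_mul tr_adj mxtrace_mulC -dualE.
by rewrite mxtrace_mulC -tr_adj adj_mul psd_herm.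
Qed.

Definition theta (X : 'M[C]_n) : 'M[C]_n :=
  2^-1 *: dual (tensmx X 1%:M + tensmx 1%:M X).

Lemma theta_is_linear : linear theta.
Proof.
move=> a X Y; rewrite /theta tensmxDl tensmxDr tensmxZl tensmxZr addrACA -scalerDr.
by rewrite linearP scalerDr !scalerA mulrC.
Qed.

HB.instance Definition _ :=
  GRing.isLinear.Build C 'M[C]_n 'M[C]_n _ theta theta_is_linear.

Lemma theta1 : theta 1%:M = 1%:M.
Proof.
rewrite /theta tensmx11 -mulr2n -scaler_nat linearZ /= dual1 scalerA.
by rewrite mulVf ?scale1r // pnatr_eq0.
Qed.

Lemma theta_adj X : theta (adj X) = adj (theta X).
Proof.
by rewrite /theta adjZ -dual_adj adjD !adj_tens adj1 fmorphV /= conjC_nat.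
Qed.

Lemma thetaE rho X :
  \tr (rho *m theta X) =
  2^-1 * (\tr (Lam rho *m tensmx X 1%:M) + \tr (Lam rho *m tensmx 1%:M X)).
Proof.
by rewrite /theta -scalemxAr linearZ /= dualE mulmxDr linearD.
Qed.

(* The range of the isometry [V] is invariant: [Lam] maps states supported on
   it to states supported on its tensor square. *)
Definition invariant r (V : 'M[C]_(n, r)) :=
  adj V *m V = 1%:M /\
  forall t, psd t -> exists2 R : 'M[C]_(r * r), psd R &
    forall X Y, \tr (Lam (V *m t *m adj V) *m tensmx X Y) =
      \tr (R *m tensmx (adj V *m X *m V) (adj V *m Y *m V)).

(** Subspaces of the range of [V] are encoded by isometries [U], which turns minimality into an
    inequality of dimensions. *)
Definition minimal r (V : 'M[C]_(n, r)) :=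
  [/\ (0 < r)%N, invariant V
    & forall s (U : 'M[C]_(r, s)), adj U *m U = 1%:M -> (0 < s)%N ->
        invariant (V *m U) -> (r <= s)%N].

Lemma invariant1 : invariant (1%:M : 'M[C]_n).
Proof.
split=> [|t tp]; first by rewrite adj1 mulmx1.
exists (Lam t); first exact: Lam_pos.
by move=> X Y; rewrite !adj1 !mul1mx !mulmx1.
Qed.

(** Take [X = Y = 1] in the invariance identity: [Lam] and the isometry preserve traces. *)
Lemma invariant_tr r (V : 'M[C]_(n, r)) t (R : 'M[C]_(r * r)) :
  adj V *m V = 1%:M ->
  (forall X Y, \tr (Lam (V *m t *m adj V) *m tensmx X Y) =
      \tr (R *m tensmx (adj V *m X *m V) (adj V *m Y *m V))) ->
  \tr R = \tr t.
Proof.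
move=> V1 /(_ 1%:M 1%:M); rewrite !mulmx1 V1 !tensmx11 !mulmx1 => <-.
by rewrite Lam_tp isometry_tr.
Qed.

(* For [t] supported on the eigenspace, [R (B (x) 1)] and [R (1 (x) B)] have
   traces at least [m \tr R] averaging to [m \tr R], so both equal it and [R]
   is supported on the tensor square of the eigenspace. *)
Lemma invariant_face r (V : 'M[C]_(n, r)) X :
  invariant V -> (0 < r)%N -> adj X = X -> theta X = X ->
  exists m s (U : 'M[C]_(r, s)),
    [/\ (0 < s)%N, adj U *m U = 1%:M, invariant (V *m U),
        psd (adj V *m X *m V - m%:M) & adj V *m X *m V *m U = m *: U].
Proof.
move=> [V1 Vinv] r0 hX fX; set B := adj V *m X *m V.
have hB : adj B = B by rewrite /B !adj_mul adjK hX mulmxA.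
have [m [s [U [P [s0 U1 Bp BU PE]]]]] := min_eigenspace hB r0.
exists m, s, U; split=> //; split.
  by rewrite adj_mul -mulmxA (mulmxA (adj V)) V1 mul1mx.
move=> t tp; have tau_p := psd_conjV U tp.
have [R Rp RE] := Vinv _ tau_p.
have trR := invariant_tr V1 RE.
pose BB1 := tensmx B (1%:M : 'M_r) - m%:M; pose BB2 := tensmx (1%:M : 'M_r) B - m%:M.
have sum0 : \tr (R *m BB1) + \tr (R *m BB2) = 0.
  rewrite !mulmxBr !linearB /= !mul_mx_scalar !linearZ /= trR.
  rewrite addrACA -opprD.
  have -> : \tr (R *m tensmx B 1%:M) + \tr (R *m tensmx 1%:M B) =
            2 * \tr (V *m (U *m t *m adj U) *m adj V *m theta X).
    rewrite thetaE mulrA mulfV ?pnatr_eq0 // mul1r !RE.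
    by rewrite !mulmx1 V1.
  rewrite fX tr_compress -/B mxtrace_mulC !mulmxA BU -!scalemxAl linearZ /=.
  by rewrite mulr_natl mulr2n subrr.
have p1 : psd BB1 by rewrite /BB1 -tensmxBl_scalar; apply: psd_tens Bp (@psd1 _ _).
have p2 : psd BB2 by rewrite /BB2 -tensmxBr_scalar; apply: psd_tens (@psd1 _ _) Bp.
have /eqP := sum0; rewrite paddr_eq0 ?tr_mul_psd_ge0 // => /andP[/eqP z1 /eqP z2].
have {}z1 := tr_mul_psd_eq0 Rp p1 z1; have {}z2 := tr_mul_psd_eq0 Rp p2 z2.
(* The complementary projection factors through [B - m%:M], so [R *m BB1 = 0] leaves [R] unchanged
   by the eigenprojection in the first tensor factor. *)
have R1 : R *m tensmx (U *m adj U) 1%:M = R.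
  have -> : U *m adj U = 1%:M - (B - m%:M) *m P by rewrite -PE opprB addrC subrK.
  rewrite -scaleN1r tensmxDl tensmxZl tensmx11 -[X in tensmx _ X]mulmx1 -tensmx_mul.
  by rewrite tensmxBl_scalar mulmxDr mulmx1 -scalemxAr mulmxA z1 mul0mx scaler0 addr0.
have R2 : R *m tensmx 1%:M (U *m adj U) = R.
  have -> : U *m adj U = 1%:M - (B - m%:M) *m P by rewrite -PE opprB addrC subrK.
  rewrite -scaleN1r tensmxDr tensmxZr tensmx11 -[X in tensmx X (_ *m _)]mulmx1 -tensmx_mul.
  by rewrite tensmxBr_scalar mulmxDr mulmx1 -scalemxAr mulmxA z2 mul0mx scaler0 addr0.
pose T := tensmx U U.
have RT : R *m (T *m adj T) = R.
  by rewrite /T adj_tens tensmx_mul tensmx_decr mulmxA R1 R2.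
have TR : T *m adj T *m R = R.
  have := congr1 (@adj C _ _) RT.
  by rewrite !adj_mul adjK (psd_herm Rp).
(* As [R] is supported on the range of [T], its compression by [T] loses nothing. *)
exists (adj T *m R *m T); first exact: psd_conj.
move=> X1 Y1; have -> : V *m U *m t *m adj (V *m U) = V *m (U *m t *m adj U) *m adj V.
  by rewrite adj_mul !mulmxA.
have TX W1 W2 : adj T *m tensmx (adj V *m W1 *m V) (adj V *m W2 *m V) *m T =
  tensmx (adj (V *m U) *m W1 *m (V *m U)) (adj (V *m U) *m W2 *m (V *m U)).
  by rewrite /T adj_tens !tensmx_mul !adj_mul !mulmxA.
rewrite -TX RE; set Z := tensmx (_ *m X1 *m _) _.
transitivity (\tr (T *m ((adj T *m R *m T) *m (adj T *m Z)))); last first.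
  by rewrite [LHS]mxtrace_mulC !mulmxA.
have -> : T *m ((adj T *m R *m T) *m (adj T *m Z)) = T *m adj T *m R *m (T *m adj T) *m Z.
  by rewrite !mulmxA.
by rewrite TR RT.
Qed.

(** * Minimal invariant subspaces and values *)

Lemma minimal_below r (V : 'M[C]_(n, r)) : invariant V -> (0 < r)%N ->
  exists s (U : 'M[C]_(r, s)), adj U *m U = 1%:M /\ minimal (V *m U).
Proof.
elim/ltn_ind: r => r IH in V *; move=> Vi r0.
(* Either a strictly smaller invariant subspace exists and induction applies to it, or [V] itself is
   minimal. *)
case: (classic (exists s (U : 'M[C]_(r, s)),
  [/\ adj U *m U = 1%:M, (0 < s)%N, invariant (V *m U) & (s < r)%N])).
  move=> [s [U [U1 s0 Ui sr]]].
  have [k [W [W1 Wm]]] := IH s sr _ Ui s0.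
  exists k, (U *m W); split; last by rewrite mulmxA.
  by rewrite adj_mul -mulmxA (mulmxA (adj U)) U1 mul1mx.
move=> noU; exists r, 1%:M; rewrite adj1 !mulmx1; split=> //; split=> // s U U1 s0 Ui.
by rewrite leqNgt; apply/negP => sr; apply: noU; exists s, U.
Qed.

(** The normalised trace is linear on all operators, and equals the scalar whenever the compression
    to [V] is one, as it is for fixed operators at minimal [V]. *)
Definition value r (V : 'M[C]_(n, r)) (X : 'M[C]_n) : C :=
  \tr (adj V *m X *m V) / r%:R.

Lemma value_scalar r (V : 'M[C]_(n, r)) X x : (0 < r)%N ->
  adj V *m X *m V = x%:M -> value V X = x.
Proof.
by move=> r0; rewrite /value => ->; rewrite mxtrace_scalar -[x *+ _]mulr_natr mulfK ?pnatr_eq0 -?lt0n.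
Qed.

Lemma value_is_scalar r (V : 'M[C]_(n, r)) : scalar (value V).
Proof.
move=> a X Y; rewrite /value mulmxDr mulmxDl linearD /= -scalemxAr -scalemxAl.
by rewrite linearZ /= mulrDl mulrA.
Qed.

HB.instance Definition _ r (V : 'M[C]_(n, r)) :=
  GRing.isLinear.Build C 'M[C]_n C _ (value V) (value_is_scalar V).

Lemma value_adj r (V : 'M[C]_(n, r)) X : value V (adj X) = (value V X)^*.
Proof.
rewrite /value rmorphM fmorphV /= conjC_nat -tr_adj !adj_mul adjK.
by rewrite mulmxA.
Qed.

(** The least eigenspace of the compression is invariant, hence by minimality the whole subspace. *)
Lemma minimal_herm_scalar r (V : 'M[C]_(n, r)) X :
  minimal V -> adj X = X -> theta X = X ->
  adj V *m X *m V = (value V X)%:M.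
Proof.
move=> [r0 Vi Vm] hX fX.
have [m [s [U [s0 U1 Ui _ XU]]]] := invariant_face Vi r0 hX fX.
have sr : s = r by apply/eqP; rewrite eqn_leq (Vm s U) // (mulmx1_min U1).
case: r / sr in V U U1 Ui XU r0 Vi Vm *.
have E : adj V *m X *m V = m%:M.
  by rewrite -[LHS]mulmx1 -(mulmx1C U1) mulmxA XU -scalemxAl mulmx1C // scalemx1.
by rewrite (value_scalar r0 E).
Qed.

Definition re (X : 'M[C]_n) := 2^-1 *: (X + adj X).

Lemma re_adj X : adj (re X) = re X.
Proof. by rewrite /re adjZ adjD adjK fmorphV /= conjC_nat addrC. Qed.

Lemma re_decomp X : X = re X + 'i *: re (- 'i *: X).
Proof.
have -> : 'i *: re (- 'i *: X) = 2^-1 *: (X - adj X).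
  rewrite /re adjZ rmorphN /= conjCi opprK scalerA mulrC -scalerA scalerDr !scalerA.
  by rewrite mulrN -expr2 sqrCi opprK scale1r scaleN1r.
rewrite /re -scalerDr addrACA subrr addr0.
by rewrite -mulr2n -scaler_nat scalerA mulVf ?scale1r // pnatr_eq0.
Qed.

Lemma fix_re X : theta X = X -> theta (re X) = re X.
Proof. by move=> fX; rewrite /re linearZ /= linearD /= theta_adj fX. Qed.

Lemma fixZ a X : theta X = X -> theta (a *: X) = a *: X.
Proof. by move=> fX; rewrite linearZ /= fX. Qed.

Lemma minimal_scalar r (V : 'M[C]_(n, r)) X :
  minimal V -> theta X = X -> adj V *m X *m V = (value V X)%:M.
Proof.
move=> Vm fX; have r0 : (0 < r)%N by case: Vm.
have Er := minimal_herm_scalar Vm (re_adj _) (fix_re fX).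
have Ei := minimal_herm_scalar Vm (re_adj _) (fix_re (fixZ (- 'i) fX)).
move: (re_decomp X) Er Ei; move: (re X) (re (- 'i *: X)) => A B -> EA EB.
rewrite mulmxDr mulmxDl -scalemxAr -scalemxAl EA EB linearD /= linearZ /=.
by apply/matrixP=> i j; rewrite !mxE mulrnDl mulrnAr.
Qed.

(** * Fixed operators, coboundaries and products of values *)

Hypothesis n_gt0 : (0 < n)%N.

(** The eigenspace at the least eigenvalue [m] is invariant and contains a minimal subspace, at
    which the value of [X] is [m]; hence [m] is nonnegative. *)
Lemma fix_psd X : adj X = X -> theta X = X ->
  (forall r (V : 'M[C]_(n, r)), minimal V -> 0 <= value V X) -> psd X.
Proof.
move=> hX fX X0.
have [m [s [U [s0 U1 Ui Xp XU]]]] := invariant_face invariant1 n_gt0 hX fX.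
rewrite adj1 mul1mx !mulmx1 in Xp XU; rewrite mul1mx in Ui.
have [k [W [W1 Wm]]] := minimal_below Ui s0.
have k0 : (0 < k)%N by case: Wm.
have vm : value (U *m W) X = m.
  apply: value_scalar => //; rewrite adj_mul -mulmxA (mulmxA X) XU -scalemxAl.
  by rewrite -scalemxAr -mulmxA (mulmxA (adj U)) U1 mul1mx W1 scalemx1.
rewrite -[X](subrK m%:M) -scalemx1; apply: psdD; first by rewrite scalemx1.
by apply: psdZ; [rewrite -vm X0|apply: psd1].
Qed.

(** The Hermitian part and its negative are both positive by [fix_psd], so it vanishes;
    multiplication by [- 'i] reduces the other part to this case. *)
Lemma fix_eq0 X : theta X = X ->
  (forall r (V : 'M[C]_(n, r)), minimal V -> value V X = 0) -> X = 0.
Proof.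
move=> fX X0.
have re0 Y : theta Y = Y ->
    (forall r (V : 'M[C]_(n, r)), minimal V -> value V Y = 0) -> re Y = 0.
  move=> fY Y0.
  have v0 r (V : 'M[C]_(n, r)) : minimal V -> value V (re Y) = 0.
    by move=> Vm; rewrite /re linearZ /= linearD /= value_adj Y0 // conjC0 addr0 mulr0.
  apply: psdN_eq0; apply: fix_psd.
  - exact: re_adj.
  - exact: fix_re.
  - by move=> r V Vm; rewrite v0.
  - by rewrite adjN re_adj.
  - by rewrite linearN /= fix_re.
  - by move=> r V Vm; rewrite linearN /= v0 ?oppr0.
rewrite (re_decomp X) re0 // re0 ?scaler0 ?addr0 //; first exact: fixZ.
by move=> r V Vm; rewrite linearZ /= X0 ?mulr0.
Qed.

(* Maximum principle: on an invariant range, [theta W] dominates the least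
   eigenvalue of [W], so [W - theta W] cannot be a positive constant there. *)
Lemma coboundary_le0 r (V : 'M[C]_(n, r)) W c :
  invariant V -> (0 < r)%N -> adj W = W ->
  (forall t, psd t -> \tr (V *m t *m adj V *m (W - theta W)) = c * \tr t) ->
  c <= 0.
Proof.
move=> [V1 Vinv] r0 hW Wc; set B := adj V *m W *m V.
have hB : adj B = B by rewrite /B !adj_mul adjK hW mulmxA.
have [m [s [U [P [s0 U1 Bp BU _]]]]] := min_eigenspace hB r0.
have tp : psd (U *m adj U) by rewrite -{1}[U]adjK; apply: psd_gram.
have trt : \tr (U *m adj U) = s%:R by rewrite mxtrace_mulC U1 mxtrace1.
have [R Rp RE] := Vinv _ tp; have trR := invariant_tr V1 RE.
have := Wc _ tp; rewrite mulmxBr linearB /= tr_compress -/B.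
rewrite mxtrace_mulC [B *m _]mulmxA BU -scalemxAl linearZ /= thetaE !RE !mulmx1 V1 -/B => E.
have h1 : m * \tr R <= \tr (R *m tensmx B 1%:M).
  by apply: tr_mul_ge_scalar => //; rewrite -tensmxBl_scalar; apply: psd_tens (@psd1 _ _).
have h2 : m * \tr R <= \tr (R *m tensmx 1%:M B).
  by apply: tr_mul_ge_scalar => //; rewrite -tensmxBr_scalar; apply: psd_tens Bp; apply: psd1.
have : c * \tr (U *m adj U) <= 0.
  rewrite -E subr_le0 -trR ler_pdivlMl ?ltr0n // mulr_natl mulr2n.
  exact: lerD.
by rewrite trt pmulr_lle0 // ltr0n.
Qed.

(** The pairs of [W] and [c] satisfying the hypothesis are closed under linear combinations and
    adjoints. For Hermitian [W] the maximum principle applies to both signs, which kills the real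
    parts of [c] and of [- 'i * c]. *)
Lemma coboundary_eq0 r (V : 'M[C]_(n, r)) W c :
  invariant V -> (0 < r)%N ->
  (forall t, psd t -> \tr (V *m t *m adj V *m (W - theta W)) = c * \tr t) ->
  c = 0.
Proof.
move=> Vi r0 Wc.
have cobZ a Y b : (forall t, psd t -> \tr (V *m t *m adj V *m (Y - theta Y)) = b * \tr t) ->
    forall t, psd t -> \tr (V *m t *m adj V *m (a *: Y - theta (a *: Y))) = (a * b) * \tr t.
  by move=> Yb t tp; rewrite [theta (_ *: _)]linearZ /= -scalerBr -scalemxAr linearZ /= Yb // mulrA.
have cobD Y Z b d : (forall t, psd t -> \tr (V *m t *m adj V *m (Y - theta Y)) = b * \tr t) ->
    (forall t, psd t -> \tr (V *m t *m adj V *m (Z - theta Z)) = d * \tr t) ->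
    forall t, psd t -> \tr (V *m t *m adj V *m (Y + Z - theta (Y + Z))) = (b + d) * \tr t.
  move=> Yb Zd t tp; rewrite [theta (_ + _)]linearD /= opprD addrACA mulmxDr linearD /=.
  by rewrite Yb // Zd // mulrDl.
have cobA Y b : (forall t, psd t -> \tr (V *m t *m adj V *m (Y - theta Y)) = b * \tr t) ->
    forall t, psd t -> \tr (V *m t *m adj V *m (adj Y - theta (adj Y))) = b^* * \tr t.
  move=> Yb t tp; rewrite theta_adj -adjN -adjD -[in LHS](psd_herm (psd_conjV V tp)).
  by rewrite -adj_mul tr_adj mxtrace_mulC Yb // rmorphM /= -tr_adj psd_herm.
have herm0 Y b : adj Y = Y ->
    (forall t, psd t -> \tr (V *m t *m adj V *m (Y - theta Y)) = b * \tr t) -> b = 0.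
  move=> hY Yb; apply/eqP; rewrite eq_le (coboundary_le0 Vi r0 hY Yb) /=.
  have hN : adj (-1 *: Y) = -1 *: Y by rewrite scaleN1r adjN hY.
  by have := coboundary_le0 Vi r0 hN (cobZ (-1) _ _ Yb); rewrite mulN1r oppr_le0.
have cobR Y b : (forall t, psd t -> \tr (V *m t *m adj V *m (Y - theta Y)) = b * \tr t) ->
   2^-1 * (b + b^*) = 0.
  by move=> Yb; apply: (herm0 (re Y)); [apply: re_adj|apply: cobZ; apply: cobD (cobA _ _ Yb)].
have := cobR _ _ Wc; have := cobR _ _ (cobZ (- 'i) _ _ Wc).
rewrite rmorphM rmorphN /= conjCi opprK mulNr.
have h2 : (2^-1 : C) != 0 by rewrite invr_eq0 pnatr_eq0.
move/eqP; rewrite mulf_eq0 (negPf h2) /= addrC -mulrBr mulf_eq0 (negPf (neq0Ci _)) /= subr_eq0.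
move=> /eqP ->; rewrite -mulr2n => /eqP; rewrite mulf_eq0 (negPf h2) /= mulrn_eq0 /=.
by move=> /eqP.
Qed.

(** With [f] the map [1 - theta], suppose [f W] is fixed. It is then a scalar on each minimal
    subspace, [coboundary_eq0] makes that scalar 0, and [fix_eq0] gives [f W = 0]; so
    [ker_im_decomp] applies. *)
Lemma fix_decomp X : exists Z W, theta Z = Z /\ X = Z + (W - theta W).
Proof.
pose f := (idfun \- theta : 'M[C]_n -> 'M[C]_n).
have ff W : f (f W) = 0 -> f W = 0.
  move=> /eqP; rewrite {1}/f /= subr_eq0 => /eqP fY; apply: fix_eq0; first by rewrite -fY.
  move=> r V Vm; have [r0 Vi _] := Vm.
  apply: (coboundary_eq0 (W := W) Vi r0) => t tp.
  rewrite tr_compress (minimal_scalar Vm) -?fY //.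
  by rewrite mul_mx_scalar linearZ.
have [Z [W [/eqP fZ ->]]] := ker_im_decomp ff X.
by exists Z, W; split=> //; apply/esym/eqP; rewrite -subr_eq0.
Qed.

(** In the splitting of [X], both [X] and its fixed part [Z] are constant on a minimal subspace.
    Their difference is a coboundary that is constant there, hence 0. *)
Lemma fix_extend X :
  (forall r (V : 'M[C]_(n, r)), minimal V -> forall t, psd t ->
     \tr (V *m t *m adj V *m X) = value V X * \tr t) ->
  exists2 Z, theta Z = Z & forall r (V : 'M[C]_(n, r)), minimal V -> value V Z = value V X.
Proof.
move=> Xv; have [Z [W [fZ eqX]]] := fix_decomp X; exists Z => // r V Vm.
have [r0 Vi _] := Vm.
apply/eqP; rewrite eq_sym -subr_eq0; apply/eqP/(coboundary_eq0 (W := W) Vi r0) => t tp.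
have -> : W - theta W = X - Z by rewrite eqX [RHS]addrC addKr.
rewrite mulmxBr linearB /= Xv // tr_compress minimal_scalar // mul_mx_scalar linearZ /=.
by rewrite mulrBl.
Qed.

(* Broadcasting turns [X, Y] into the joint observable [dual (X (x) Y)], whose
   value at a minimal range is the product of the values. *)
Lemma fix_mul X Y : theta X = X -> theta Y = Y ->
  exists2 Z, theta Z = Z & forall r (V : 'M[C]_(n, r)), minimal V ->
    value V Z = value V X * value V Y.
Proof.
move=> fX fY.
have E r (V : 'M[C]_(n, r)) : minimal V -> forall t, psd t ->
    \tr (V *m t *m adj V *m dual (tensmx X Y)) = value V X * value V Y * \tr t.
  move=> Vm t tp; have [r0 [V1 Vi] _] := Vm; have [R Rp RE] := Vi t tp.
  rewrite dualE RE !(minimal_scalar Vm) // -(invariant_tr V1 RE).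
  rewrite -[X in tensmx X _]scalemx1 -[X in tensmx _ X]scalemx1.
  by rewrite tensmxZl tensmxZr tensmx11 scalerA -scalemxAr mulmx1 linearZ.
have v r (V : 'M[C]_(n, r)) : minimal V ->
    value V (dual (tensmx X Y)) = value V X * value V Y.
  move=> Vm; have [r0 _ _] := Vm; have := E r V Vm 1%:M (@psd1 _ _).
  rewrite tr_compress mul1mx mxtrace1 /value => ->.
  by rewrite mulfK // pnatr_eq0 -lt0n.
have [Z fZ Zv] : exists2 Z, theta Z = Z &
    forall r (V : 'M[C]_(n, r)), minimal V -> value V Z = value V (dual (tensmx X Y)).
  by apply: fix_extend => r V Vm t tp; rewrite v // E.
by exists Z => // r V Vm; rewrite Zv // v.
Qed.

(** The maximally mixed state on the range of [V] realises the value, so values are expectations in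
    genuine states. *)
Lemma value_state r (V : 'M[C]_(n, r)) : minimal V ->
  is_state (r%:R^-1 *: (V *m adj V)) /\
  forall X, \tr (r%:R^-1 *: (V *m adj V) *m X) = value V X.
Proof.
move=> [r0 [V1 _] _]; split; last first.
  by move=> X; rewrite -scalemxAl linearZ /= -mulmxA mxtrace_mulC mulrC.
split; last by rewrite linearZ /= mxtrace_mulC V1 mxtrace1 mulVf // pnatr_eq0 -lt0n.
apply: psdZ; first by rewrite invr_ge0 ler0n.
by rewrite -{1}[V]adjK; apply: psd_gram.
Qed.

End Broadcast.

Lemma big_tens (C : numClosedFieldType) m n (F : 'I_(m * n) -> C) :
  \sum_k F k = \sum_i \sum_j F (mxtens_index (i, j)).
Proof.
rewrite pair_big /= (reindex (@mxtens_index m n)) /=; first by apply: eq_bigr => -[].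
by exists (@mxtens_unindex m n) => i _; rewrite (mxtens_indexK, mxtens_unindexK).
Qed.

(** Turns an indexed family into a list, the format of POVMs. The size equation is kept explicit so
    that eliminating it reduces [cast_ord] to the identity. *)
Lemma fam_seq T (x0 : T) r (g : 'I_r -> T) :
  exists s (e : size s = r), forall i : 'I_(size s), nth x0 s i = g (cast_ord e i).
Proof.
have e : size (codom g) = r by rewrite size_codom card_ord.
exists (codom g), e => i; rewrite (nth_map (cast_ord e i)).
  by rewrite (nth_ord_enum _ (cast_ord e i)).
by rewrite size_enum_ord (ltn_ord (cast_ord e i)).
Qed.

(** * Biorthogonal systems *)

Section Biorthogonal.
Variables (C : numClosedFieldType) (n : nat) (K Ch : 'M[C]_n -> Prop).
Hypothesis K_lin : forall a X Y, K X -> K Y -> K (a *: X + Y).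
Hypothesis Ch_sep : forall X, K X -> (forall s, Ch s -> \tr (s *m X) = 0) -> X = 0.

(** [K] is a linear space of operators, and [Ch] a set of trace functionals separating its
    points. *)
Definition biorthogonal r (g s : 'I_r -> 'M[C]_n) :=
  [/\ forall i, K (g i), forall i, Ch (s i)
    & forall i j, \tr (s i *m g j) = (i == j)%:R].

(** The pairing factors the identity of size [r] through the space of operators, which has dimension
    [n * n]. *)
Lemma biorthogonal_bound r (g s : 'I_r -> 'M[C]_n) :
  biorthogonal g s -> (r <= n * n)%N.
Proof.
move=> [_ _ gs].
pose M1 : 'M[C]_(r, n * n) :=
  \matrix_(i, k) s i (mxtens_unindex k).1 (mxtens_unindex k).2.
pose M2 : 'M[C]_(n * n, r) :=
  \matrix_(k, j) g j (mxtens_unindex k).2 (mxtens_unindex k).1.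
apply: (@mulmx1_min _ _ _ M1 M2); apply/matrixP=> i j; rewrite mxE big_tens.
rewrite [RHS]mxE -gs; apply: eq_bigr => a _; rewrite mxE; apply: eq_bigr => b _.
by rewrite !mxE !mxtens_indexK.
Qed.

(** A Gram-Schmidt step: [X] is normalised against some [t] that sees it, and multiples of it are
    subtracted from the old [g j] so that [t] vanishes on them. *)
Lemma biorthogonal_extend r (g s : 'I_r -> 'M[C]_n) X :
  biorthogonal g s -> K X -> (forall i, \tr (s i *m X) = 0) -> X <> 0 ->
  exists g' s' : 'I_r.+1 -> 'M[C]_n, biorthogonal g' s'.
Proof.
move=> [Kg Cs gs] KX sX X0.
have [t [Ct tX]] : exists t, Ch t /\ \tr (t *m X) <> 0.
  apply: NNPP => nt; apply: X0; apply: Ch_sep => // t Ct.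
  by apply: NNPP => tX; apply: nt; exists t.
pose x := \tr (t *m X).
have x0 : x != 0 by apply/eqP.
have K0 : K 0 by have := K_lin (-1) KX KX; rewrite scaleN1r addNr.
pose X1 := x^-1 *: X.
have tX1 : \tr (t *m X1) = 1 by rewrite /X1 -scalemxAr linearZ /= mulVf.
have sX1 i : \tr (s i *m X1) = 0 by rewrite /X1 -scalemxAr linearZ /= sX mulr0.
have KX1 : K X1 by have := K_lin x^-1 KX K0; rewrite addr0.
exists (fun i => if unlift ord0 i is Some j then - \tr (t *m g j) *: X1 + g j else X1).
exists (fun i => if unlift ord0 i is Some j then s j else t).
split=> [i|i|i j]; first by case: unliftP => // j _; apply: K_lin.
  by case: unliftP.
case: (unliftP ord0 i) => [i' ->|->]; case: (unliftP ord0 j) => [j' ->|->].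
- by rewrite mulmxDr linearD /= -scalemxAr linearZ /= sX1 mulr0 add0r gs.
- by rewrite sX1.
- by rewrite mulmxDr linearD /= -scalemxAr linearZ /= tX1 mulr1 addNr.
- by rewrite tX1 eqxx.
Qed.

(** If no system were complete, repeated extension would exceed the dimension bound. *)
Lemma biorthogonal_complete : exists r (g s : 'I_r -> 'M[C]_n),
  biorthogonal g s /\
  forall X, K X -> (forall i, \tr (s i *m X) = 0) -> X = 0.
Proof.
apply: NNPP => no.
have ex r : exists g s : 'I_r -> 'M[C]_n, biorthogonal g s.
  elim: r => [|r [g [s gs]]]; first by exists (fun _ => 0), (fun _ => 0); split=> -[].
  apply: NNPP => nr; apply: no; exists r, g, s; split=> // X KX sX.
  by apply: NNPP => X0; apply: nr; apply: biorthogonal_extend gs KX sX X0.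
have [g [s /biorthogonal_bound]] := ex (n * n).+1.
by rewrite ltnn.
Qed.

End Biorthogonal.

(** * Finite models and elimination of outcomes *)

Section Models.
Variables (C : numClosedFieldType) (n : nat) (calA : seq 'M[C]_n -> Prop).

(** Ordinal-indexed families, rather than lists, let [lift] remove an outcome. *)
Definition model r (g s : 'I_r -> 'M[C]_n) :=
  [/\ forall i, psd (g i), \sum_i g i = 1%:M, forall i, is_state (s i)
    & forall A, calA A -> forall k : 'I_(size A),
        A`_k = \sum_i \tr (s i *m A`_k) *: g i].

Lemma state_tr_ge0 (s A : 'M[C]_n) : is_state s -> psd A -> 0 <= \tr (s *m A).
Proof. by move=> [sp _]; apply: tr_mul_psd_ge0. Qed.

Lemma noncontextual_model : no_contextuality_proof calA ->
  exists r (g s : 'I_r -> 'M[C]_n), model g s.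
Proof.
move=> [G [s [[Gp G1] [sS GA]]]].
exists (size G), (fun i => G`_i), s; split=> // A cA k.
apply: eq_tr_state => rho rS; rewrite (GA A cA k rho rS) mulmx_sumr linear_sum.
by apply: eq_bigr => i _; rewrite -scalemxAr linearZ /= mulrC.
Qed.

Lemma model_noncontextual r (g s : 'I_r -> 'M[C]_n) :
  model g s -> no_contextuality_proof calA.
Proof.
have [G [e Ge]] := fam_seq 0 g; move=> [gp g1 sS gA].
case: r / e g s gp g1 sS gA Ge => g s gp g1 sS gA Ge.
have {}Ge (i : 'I_(size G)) : G`_i = g i by rewrite Ge cast_ord_id.
exists G, s; split; last split=> // A cA k rho rS.
  by split=> [k|]; [rewrite Ge|rewrite -g1; apply: eq_bigr => i _; rewrite Ge].
rewrite {1}gA // mulmx_sumr linear_sum; apply: eq_bigr => i _.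
by rewrite -scalemxAr linearZ /= mulrC Ge.
Qed.

(* If [p = tr (s_j g_j) <> 1], the reconstruction formula for [A_k] tested on
   [s_j] expresses [tr (s_j A_k)] through the other values, with coefficients
   [tr (s_j g_i) / (1 - p)]; so the outcome [j] can be merged into the others. *)
Lemma model_eliminate r (g s : 'I_r.+1 -> 'M[C]_n) j :
  model g s -> \tr (s j *m g j) != 1 ->
  exists g' s' : 'I_r -> 'M[C]_n, model g' s'.
Proof.
move=> [gp g1 sS gA] p1; pose p i := \tr (s j *m g i).
have p0 i : 0 <= p i by apply: state_tr_ge0.
have sump : \sum_i p i = 1.
  by rewrite /p -linear_sum -mulmx_sumr g1 mulmx1; case: (sS j).
have sump' : \sum_i p (lift j i) = 1 - p j.
  by rewrite -sump (bigD1_ord j) //= addrC addrK.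
have q0 : 0 <= 1 - p j by rewrite -sump' sumr_ge0.
have qN : 1 - p j != 0 by rewrite subr_eq0 eq_sym.
pose c i := p (lift j i) / (1 - p j).
have sumc : \sum_i c i = 1 by rewrite -mulr_suml sump' mulfV.
exists (fun i => g (lift j i) + c i *: g j), (fun i => s (lift j i)); split=> //.
- by move=> i; apply: psdD => //; apply: psdZ => //; rewrite divr_ge0.
- by rewrite big_split /= -scaler_suml sumc scale1r addrC -g1 [RHS](bigD1_ord j).
move=> A cA k; have Ek := gA A cA k.
have E : \tr (s j *m A`_k) = p j * \tr (s j *m A`_k) +
    \sum_i p (lift j i) * \tr (s (lift j i) *m A`_k).
  rewrite {1}Ek mulmx_sumr linear_sum (bigD1_ord j) //=.
  rewrite -scalemxAr linearZ /= mulrC; congr (_ + _); apply: eq_bigr => i _.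
  by rewrite -scalemxAr linearZ /= mulrC.
have Ej : \tr (s j *m A`_k) = \sum_i c i * \tr (s (lift j i) *m A`_k).
  apply: (mulfI qN); rewrite [LHS]mulrBl mul1r {1}E [X in X - _]addrC addrK.
  by rewrite [RHS]mulr_sumr; apply: eq_bigr => i _; rewrite mulrA [_ * c i]mulrC divfK.
rewrite {1}Ek (bigD1_ord j) //= Ej scaler_suml addrC -big_split /=.
by apply: eq_bigr => i _; rewrite scalerDr scalerA [c i * _]mulrC.
Qed.

Definition sharp_model (G : seq 'M[C]_n) (s : 'I_(size G) -> 'M[C]_n) :=
  [/\ is_povm G, forall l, is_state (s l), forall l, \tr (s l *m G`_l) = 1
    & forall A, calA A -> forall k : 'I_(size A),
        A`_k = \sum_l \tr (s l *m A`_k) *: G`_l].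

Lemma model_sharp r (g s : 'I_r -> 'M[C]_n) : model g s ->
  exists G (t : 'I_(size G) -> 'M[C]_n), sharp_model t.
Proof.
elim: r => [|r IH] in g s *; last first.
  move=> gs; case: (boolP [forall j, \tr (s j *m g j) == 1]); last first.
    move=> /forallPn[j /(model_eliminate gs)[g' [s' gs']]].
    exact: IH gs'.
  move=> /forallP sh; move: r.+1 g s gs sh {IH} => {}r g s [gp g1 sS gA] sh.
  have [G [e Ge]] := fam_seq 0 g.
  case: r / e g s gp g1 sS gA sh Ge => g s gp g1 sS gA sh Ge.
  have {}Ge (i : 'I_(size G)) : G`_i = g i by rewrite Ge cast_ord_id.
  exists G, s; split=> //.
  - by split=> [k|]; [rewrite Ge|rewrite -g1; apply: eq_bigr => i _; rewrite Ge].
  - by move=> l; rewrite Ge; apply/eqP.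
  by move=> A cA k; rewrite {1}gA //; apply: eq_bigr => i _; rewrite Ge.
(* Without outcomes the empty sum equals [1%:M], and the empty list is a sharp model. *)
move=> [_ g1 _ gA]; exists [::].
exists (fun _ => 0); split=> //; try by case.
  by split; [case|rewrite -g1 !big_ord0].
by move=> A cA k; rewrite {1}gA // !big_ord0.
Qed.

Lemma povm_subr (G : seq 'M[C]_n) (l : 'I_(size G)) : is_povm G -> psd (1%:M - G`_l).
Proof.
move=> [Gp <-]; rewrite (bigD1 l) //= addrC addrK.
exact: psd_sum.
Qed.

(** Outcome probabilities are nonnegative and sum to 1, so a certain outcome leaves 0 for the
    others. *)
Lemma sharp_orthogonal (G : seq 'M[C]_n) (l m : 'I_(size G)) (s : 'M[C]_n) :
  is_povm G -> is_state s -> \tr (s *m G`_l) = 1 ->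
  \tr (s *m G`_m) = (l == m)%:R.
Proof.
move=> [Gp G1] sS sl; case: eqVneq => [<- //|lm].
have : \sum_(i < size G) \tr (s *m G`_i) = 1.
  by rewrite -linear_sum -mulmx_sumr G1 mulmx1; case: sS.
rewrite (bigD1 l) //= sl -[RHS]addr0 => /addrI /eqP.
rewrite psumr_eq0 => [/allP/(_ m (mem_index_enum _))|i _]; last exact: state_tr_ge0.
by rewrite eq_sym lm => /eqP.
Qed.

Lemma sharp_post_processing (G : seq 'M[C]_n) (s : 'I_(size G) -> 'M[C]_n) A :
  sharp_model s -> calA A -> is_povm A -> post_processing A G.
Proof.
move=> [_ sS _ GA] cA [Ap A1]; exists (fun k l => \tr (s l *m A`_k)).
split=> [k l|]; first exact: state_tr_ge0.
split=> [l|k]; last exact: GA.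
by rewrite -linear_sum -mulmx_sumr A1 mulmx1; case: (sS l).
Qed.

(** The state [s l] triggers only outcome [l], so its expectation of [A_k] is the coefficient
    [p k l]. Vanishing effects, which a repeatable POVM may contain, drop out of the sum. *)
Lemma post_processing_noncontextual (G : seq 'M[C]_n) (s : 'I_(size G) -> 'M[C]_n) :
  is_povm G -> (forall l, is_state (s l)) ->
  (forall l : 'I_(size G), G`_l != 0 -> \tr (s l *m G`_l) = 1) ->
  (forall A, calA A -> post_processing A G) -> no_contextuality_proof calA.
Proof.
move=> PG sS sG GA; exists G, s; split=> //; split=> // A /GA[p [_ [_ pE]]] k rho _.
rewrite {1}pE mulmx_sumr linear_sum; apply: eq_bigr => l _.
rewrite -scalemxAr linearZ /=; have [->|Gl] := eqVneq G`_l 0.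
  by rewrite mulmx0 linear0 mulr0 mul0r.
rewrite mulrC; congr (_ * _); rewrite pE mulmx_sumr linear_sum (bigD1 l) //=.
rewrite -scalemxAr linearZ /= sG // mulr1 big1 ?addr0 // => m ml.
by rewrite -scalemxAr linearZ /= (sharp_orthogonal m PG (sS l) (sG l Gl)) eq_sym (negPf ml) mulr0.
Qed.

End Models.

(** * Equivalence of the four conditions *)

Section Theorem2.
Variable C : numClosedFieldType.

(** * Partial traces, and from broadcasting to a model *)

Lemma tr_ptrace2 n (A : 'M[C]_n) Y :
  \tr (A *m ptrace2 Y) = \tr (Y *m tensmx A 1%:M).
Proof.
rewrite [RHS]mxtrace_mulC /mxtrace big_tens; apply: eq_bigr => i _.
transitivity (\sum_j \sum_k A i j * Y (mxtens_index (j, k)) (mxtens_index (i, k))).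
  by rewrite mxE; apply: eq_bigr => j _; rewrite mxE mulr_sumr.
rewrite exchange_big; apply: eq_bigr => k _ /=.
rewrite mxE big_tens; apply: eq_bigr => j _.
rewrite (bigD1 k) //= tensmxE mxE eqxx mulr1 big1 ?addr0 // => l /negPf lk.
by rewrite tensmxE mxE eq_sym lk mulr0 mul0r.
Qed.

Lemma tr_ptrace1 n (A : 'M[C]_n) Y :
  \tr (A *m ptrace1 Y) = \tr (Y *m tensmx 1%:M A).
Proof.
rewrite [RHS]mxtrace_mulC /mxtrace big_tens exchange_big; apply: eq_bigr => i _ /=.
transitivity (\sum_j \sum_k A i j * Y (mxtens_index (k, j)) (mxtens_index (k, i))).
  by rewrite mxE; apply: eq_bigr => j _; rewrite mxE mulr_sumr.
rewrite exchange_big; apply: eq_bigr => k _ /=.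
rewrite mxE big_tens [RHS](bigD1 k) //= [X in _ + X]big1 ?addr0 => [|l /negPf lk].
  by apply: eq_bigr => j _; rewrite tensmxE mxE eqxx mul1r.
by apply: big1 => j _; rewrite tensmxE mxE eq_sym lk !mul0r.
Qed.

(** The amplification by a one-dimensional space, with positivity tested by traces. *)
Lemma completely_positive_psd n p (f : 'M[C]_n -> 'M[C]_p) rho :
  completely_positive f -> psd rho -> psd (f rho).
Proof.
move=> fp rp; have := fp 1%N _ (psd_tens (@psd1 C 1) rp).
rewrite /ampl !big_ord1.
have -> : \matrix_(i, j) tensmx (1%:M : 'M_1) rho (mxtens_index (ord0, i)) (mxtens_index (ord0, j)) = rho.
  by apply/matrixP=> i j; rewrite mxE tensmxE mxE eqxx mul1r.
move=> dp; apply: psd_tr => s sp.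
have := tr_mul_psd_ge0 dp (psd_tens (@psd1 C 1) sp).
by rewrite tensmx_mul tr_tens mulmx1 mxtrace_mulC trace_mx11 mxE !eqxx mul1r.
Qed.

Lemma broadcastable_noncontextual n (calA : seq 'M[C]_n -> Prop) :
  (0 < n)%N -> broadcastable (@is_state C n) calA calA -> no_contextuality_proof calA.
Proof.
move=> n0 [Lam [cp [tp [B2 B1]]]].
have pos rho : psd rho -> psd (Lam rho) by apply: completely_positive_psd.
have fixA A : calA A -> forall k : 'I_(size A), theta Lam A`_k = A`_k.
  move=> cA k; apply: eq_tr_state => rho rS.
  rewrite thetaE -tr_ptrace2 -tr_ptrace1 B2 // B1 // [\tr (rho *m _)]mxtrace_mulC.
  by rewrite -[X in 2^-1 * X]mulr2n -[X in 2^-1 * X]mulr_natl mulKf // pnatr_eq0.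
(* Fixed operators are paired with the maximally mixed states of minimal subspaces, which separate
   them by [fix_eq0]. *)
pose K X := theta Lam X = X.
pose Ch s := exists r (V : 'M[C]_(n, r)), minimal Lam V /\ s = r%:R^-1 *: (V *m adj V).
have Klin a X Y : K X -> K Y -> K (a *: X + Y).
  by move=> fX fY; rewrite /K linearP /= fX fY.
have sep X : K X -> (forall s, Ch s -> \tr (s *m X) = 0) -> X = 0.
  move=> fX X0; apply: (fix_eq0 pos tp n0 fX) => r V Vm.
  have [_ <-] := value_state Vm; apply: X0; by exists r, V.
have [r [g [s [[Kg Cs gs] comp]]]] := biorthogonal_complete Klin sep.
have sS i : is_state (s i).
  by have [k [V [Vm ->]]] := Cs i; have [] := value_state Vm.
have gherm i : adj (g i) = g i.
  apply/eqP; rewrite -subr_eq0; apply/eqP/comp => [|j].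
    by rewrite -scaleN1r addrC; apply: Klin => //; rewrite /K theta_adj // Kg.
  have [sp _] := sS j; rewrite mulmxBr linearB /= gs.
  rewrite -{1}(psd_herm sp) -adj_mul tr_adj mxtrace_mulC gs.
  by rewrite conjC_nat subrr.
(* The fixed operator with the squared values of [g i] agrees with [g i] at the chosen states, where
   the values are 0 or 1; by completeness the two coincide, so the values of [g i] are idempotent at
   every minimal subspace. *)
have gidem i : forall k (V : 'M[C]_(n, k)), minimal Lam V -> value V (g i) ^+ 2 = value V (g i).
  have [Z fZ Zv] := fix_mul pos tp n0 (Kg i) (Kg i).
  have ZE : Z = g i.
    apply/eqP; rewrite -subr_eq0; apply/eqP/comp => [|j].
      by rewrite -scaleN1r addrC; apply: Klin.
    have [k [V [Vm sE]]] := Cs j; have [_ sV] := value_state Vm.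
    rewrite mulmxBr linearB /= sE !sV Zv // -sV -sE gs.
    by case: eqP; rewrite /= ?mulr1 ?mulr0 subrr.
  by move=> k V Vm; rewrite expr2 -Zv // ZE.
have gp i : psd (g i).
  apply: (fix_psd pos tp n0 (gherm i) (Kg i)) => k V Vm.
  have /eqP := gidem i k V Vm; rewrite -subr_eq0 expr2 -{3}[value V _]mulr1 -mulrBr.
  by rewrite mulf_eq0 subr_eq0 => /orP[] /eqP ->.
have Ksum (I : seq 'I_r) (c : 'I_r -> C) : K (\sum_(i <- I) c i *: g i).
  elim: I => [|i I IH]; first by rewrite big_nil /K linear0.
  by rewrite big_cons; apply: Klin.
have expand X : K X -> X = \sum_i \tr (s i *m X) *: g i.
  move=> KX; apply/eqP; rewrite -subr_eq0; apply/eqP/comp => [|j].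
    by rewrite -scaleN1r addrC; apply: Klin.
  rewrite mulmxBr linearB /= mulmx_sumr linear_sum (bigD1 j) //=.
  rewrite -scalemxAr linearZ /= gs eqxx mulr1 big1 ?addr0 ?subrr // => i ij.
  by rewrite -scalemxAr linearZ /= gs eq_sym (negPf ij) mulr0.
apply: (@model_noncontextual _ _ _ r g s); split=> //.
  rewrite [RHS]expand; last by rewrite /K theta1.
  by apply: eq_bigr => i _; rewrite mulmx1; have [_ ->] := sS i; rewrite scale1r.
by move=> A cA k; apply/expand/fixA.
Qed.

(** * Measure-and-prepare maps *)

Definition measure_prepare n p r (g : 'I_r -> 'M[C]_n) (t : 'I_r -> 'M[C]_p)
  (rho : 'M[C]_n) : 'M[C]_p := \sum_i \tr (rho *m g i) *: t i.

Lemma measure_prepare_is_linear n p r (g : 'I_r -> 'M[C]_n) (t : 'I_r -> 'M[C]_p) :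
  linear (measure_prepare g t).
Proof.
move=> a X Y; rewrite /measure_prepare scaler_sumr -big_split; apply: eq_bigr => i _ /=.
by rewrite mulmxDl linearD /= -scalemxAl linearZ /= scalerDl scalerA.
Qed.

HB.instance Definition _ n p r (g : 'I_r -> 'M[C]_n) (t : 'I_r -> 'M[C]_p) :=
  GRing.isLinear.Build C 'M[C]_n 'M[C]_p _ (measure_prepare g t)
    (measure_prepare_is_linear g t).

(** The amplified output is a sum of [M l] tensor [t l], where [M l] contracts [X] with [g l]. It is
    positive because its form at [v] pairs [X] with the tensor product of [v *m adj v] and [g l]. *)
Lemma measure_prepare_cp n p r (g : 'I_r -> 'M[C]_n) (t : 'I_r -> 'M[C]_p) :
  (forall i, psd (g i)) -> (forall i, psd (t i)) ->
  completely_positive (measure_prepare g t).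
Proof.
move=> gp tp m X Xp.
pose blk a b : 'M[C]_n := \matrix_(i, j) X (mxtens_index (a, i)) (mxtens_index (b, j)).
pose M l : 'M[C]_m := \matrix_(a, b) \tr (blk a b *m g l).
have -> : ampl (measure_prepare g t) X = \sum_l tensmx (M l) (t l).
  apply/matrixP=> x y; case: (mxtens_indexP x) => a i; case: (mxtens_indexP y) => b j.
  rewrite /ampl !summxE (bigD1 a) //= [X in _ + X]big1 ?addr0 => [|a' /negPf aa]; last first.
    by rewrite summxE big1 // => b' _; rewrite tensmxE mxE eq_sym aa mul0r.
  rewrite summxE (bigD1 b) //= [X in _ + X]big1 ?addr0 => [|b' /negPf bb]; last first.
    by rewrite tensmxE mxE eqxx eq_sym bb mul0r.
  rewrite tensmxE mxE !eqxx mul1r summxE; apply: eq_bigr => l _.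
  by rewrite tensmxE !mxE.
apply: psd_sum => l _; apply: psd_tens => // v.
have vp : psd (v *m adj v) by rewrite -{1}[v]adjK; apply: psd_gram.
rewrite quad_tr; suff -> : \tr (v *m adj v *m M l) = \tr (X *m tensmx (v *m adj v) (g l)).
  by apply: tr_mul_psd_ge0 => //; apply: psd_tens.
rewrite mxtrace_mulC /mxtrace big_tens; apply: eq_bigr => a _.
transitivity (\sum_b \sum_i \sum_j
    X (mxtens_index (a, i)) (mxtens_index (b, j)) * ((v *m adj v) b a * g l j i)).
  rewrite mxE; apply: eq_bigr => b _; rewrite mxE mulr_suml; apply: eq_bigr => i _.
  rewrite mxE mulr_suml; apply: eq_bigr => j _.
  by rewrite mxE -mulrA [g l j i * _]mulrC.
rewrite exchange_big; apply: eq_bigr => i _ /=.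
rewrite mxE big_tens; apply: eq_bigr => b _; apply: eq_bigr => j _.
by rewrite tensmxE.
Qed.

Lemma ptrace2_tens n (A B : 'M[C]_n) : ptrace2 (tensmx A B) = \tr B *: A.
Proof.
apply/matrixP=> i j; rewrite !mxE mulrC mulr_sumr.
by apply: eq_bigr => k _; rewrite tensmxE.
Qed.

Lemma ptrace1_tens n (A B : 'M[C]_n) : ptrace1 (tensmx A B) = \tr A *: B.
Proof.
apply/matrixP=> i j; rewrite !mxE mulr_suml.
by apply: eq_bigr => k _; rewrite tensmxE.
Qed.

Lemma sharp_broadcastable n (calA : seq 'M[C]_n -> Prop) G (s : 'I_(size G) -> 'M[C]_n) :
  sharp_model calA s -> broadcastable (@is_state C n) calA calA.
Proof.
move=> [[Gp G1] sS _ GA].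
pose Lam := measure_prepare (fun l : 'I_(size G) => G`_l) (fun l => tensmx (s l) (s l)).
have marg A : calA A -> forall (k : 'I_(size A)) rho,
    \sum_(l < size G) \tr (rho *m G`_l) * \tr (A`_k *m s l) = \tr (A`_k *m rho).
  move=> cA k rho; rewrite [in RHS]mxtrace_mulC {2}(GA A cA k) mulmx_sumr linear_sum.
  apply: eq_bigr => l _; rewrite -scalemxAr linearZ /= mulrC.
  by rewrite [in LHS]mxtrace_mulC.
exists Lam; split.
  apply: measure_prepare_cp => // l; have [sp _] := sS l; exact: psd_tens.
split.
  move=> X; rewrite -[in RHS](mulmx1 X) -G1 mulmx_sumr !linear_sum; apply: eq_bigr => l _.
  by rewrite linearZ /= tr_tens; have [_ ->] := sS l; rewrite !mulr1.
split=> A cA k rho _; rewrite -[RHS]marg //.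
  rewrite tr_ptrace2 /= /Lam /measure_prepare mulmx_suml linear_sum.
  apply: eq_bigr => l _; rewrite -scalemxAl linearZ /= -tr_ptrace2 ptrace2_tens.
  by have [_ ->] := sS l; rewrite scale1r.
rewrite tr_ptrace1 /= /Lam /measure_prepare mulmx_suml linear_sum.
apply: eq_bigr => l _; rewrite -scalemxAl linearZ /= -tr_ptrace1 ptrace1_tens.
by have [_ ->] := sS l; rewrite scale1r.
Qed.

(** * Repeatable instruments *)

Lemma tr_hdual n (f : {linear 'M[C]_n -> 'M[C]_n}) X rho :
  \tr (hdual f X *m rho) = \tr (X *m f rho).
Proof.
rewrite mxtrace_mulC {2}[rho]matrix_sum_delta linear_sum mulmx_sumr linear_sum.
apply: eq_bigr => i _; rewrite mxE linear_sum mulmx_sumr linear_sum.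
by apply: eq_bigr => j _; rewrite mxE linearZ /= -scalemxAr linearZ.
Qed.

Lemma sharp_repeatable n (calA : seq 'M[C]_n -> Prop) G (s : 'I_(size G) -> 'M[C]_n) :
  sharp_model calA s -> repeatable G.
Proof.
move=> [PG sS sG _]; have [Gp G1] := PG.
pose I (l : 'I_(size G)) : {linear 'M[C]_n -> 'M[C]_n} :=
  measure_prepare (fun _ : 'I_1 => G`_l) (fun _ => s l).
have IE l X : I l X = \tr (X *m G`_l) *: s l by rewrite /I /= /measure_prepare big_ord1.
have dualI l X : hdual (I l) X = \tr (X *m s l) *: G`_l.
  apply: eq_tr_psd => rho _; rewrite mxtrace_mulC tr_hdual IE -!scalemxAr !linearZ /=.
  exact: mulrC.
have trI l X : \tr (I l X) = \tr (X *m G`_l).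
  by rewrite IE linearZ /=; have [_ ->] := sS l; rewrite mulr1.
exists I; split; last split.
- split; first by move=> l; apply: measure_prepare_cp => // _; have [] := sS l.
  split=> [l X Xp|X]; last first.
    rewrite linear_sum -[in RHS](mulmx1 X) -G1 mulmx_sumr linear_sum.
    by apply: eq_bigr => l _; apply: trI.
  rewrite trI -subr_ge0 -[in X in X - _](mulmx1 X) -linearB -mulmxBr.
  exact/tr_mul_psd_ge0/povm_subr.
- by move=> l; rewrite dualI mul1mx; have [_ ->] := sS l; rewrite scale1r.
by move=> l; rewrite dualI mxtrace_mulC sG scale1r.
Qed.

Lemma repeatable_noncontextual n (calA : seq 'M[C]_n -> Prop) (G : seq 'M[C]_n) :
  (0 < n)%N -> is_povm G -> repeatable G ->
  (forall A, calA A -> post_processing A G) -> no_contextuality_proof calA.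
Proof.
move=> n0 PG [I [[Icp _] [impl rep]]] GA.
have trI1 (l : 'I_(size G)) : \tr (I l 1%:M) = \tr G`_l.
  by rewrite -[I l _]mul1mx -tr_hdual impl mulmx1.
pose s (l : 'I_(size G)) :=
  if G`_l == 0 then n%:R^-1 *: 1%:M else (\tr (I l 1%:M))^-1 *: I l 1%:M.
have [Gp _] := PG.
have I1p l : psd (I l 1%:M) by apply/completely_positive_psd/psd1/Icp.
have trG (l : 'I_(size G)) : G`_l != 0 -> \tr G`_l != 0.
  by apply: contra_neq; apply: tr_psd_eq0.
apply: (post_processing_noncontextual (s := s) PG _ _ GA) => l.
  rewrite /s; case: ifPn => [_|Gl].
    split; first by apply: psdZ (@psd1 _ _); rewrite invr_ge0 ler0n.
    by rewrite linearZ /= mxtrace1 mulVf // pnatr_eq0 -lt0n.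
  by apply: psd_normalize => //; apply: contraNneq (trG l Gl) => I0; rewrite -trI1 I0 linear0.
move=> Gl; rewrite /s (negPf Gl) -scalemxAl linearZ /= mxtrace_mulC -tr_hdual rep mulmx1.
by rewrite trI1 mulVf // trG.
Qed.

(** * Effects of operator norm one *)

Lemma vnorm_le n (v : 'cV[C]_n) c : 0 <= c ->
  (vnorm v <= c) = ((adj v *m v) 0 0 <= c ^+ 2).
Proof.
move=> c0; have v0 : 0 <= (adj v *m v) 0 0 by rewrite -trace_mx11 tr_gram_ge0.
by rewrite -(ler_pXn2r (n := 2)) ?nnegrE ?sqrtC_ge0 // sqrtCK.
Qed.

Lemma vnorm1P n (v : 'cV[C]_n) : vnorm v = 1 <-> (adj v *m v) 0 0 = 1.
Proof.
split=> [v1|]; last by rewrite /vnorm => ->; rewrite sqrtC1.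
by rewrite -[LHS]sqrtCK -/(vnorm v) v1 expr1n.
Qed.

(** With [Y = 1 - X], which commutes with [X], the operator [1 - X^2] is [Y + X Y X + Y X Y], a sum
    of positive terms. *)
Lemma effect_vnorm n (X : 'M[C]_n) (v : 'cV[C]_n) :
  psd X -> psd (1%:M - X) -> vnorm v = 1 -> vnorm (X *m v) <= 1.
Proof.
move=> Xp Yp /vnorm1P v1; rewrite vnorm_le // expr1n.
have hX := psd_herm Xp; set Y := 1%:M - X in Yp *.
have hY := psd_herm Yp.
have eqY : 1%:M - X *m X = Y + (adj X *m Y *m X + adj Y *m X *m Y).
  have XY : X *m Y = Y *m X by rewrite /Y mulmxBr mulmxBl mulmx1 mul1mx.
  have -> : adj X *m Y *m X + adj Y *m X *m Y = X *m Y.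
    by rewrite hX hY -XY -mulmxDr [X + _]addrC subrK mulmx1.
  by rewrite /Y mulmxBr mulmx1 addrA subrK.
have : psd (1%:M - X *m X).
  by rewrite eqY; apply/psdD/psdD/psd_conj => //; apply: psd_conj.
move=> /(_ v); rewrite mulmxBr mulmxBl mulmx1 mxE v1 mxE subr_ge0.
by rewrite adj_mul hX !mulmxA.
Qed.

(** Certainty of outcome [l] forces [G]_l *m s l = s l[, so a normalised nonzero column of]s
    l[is a unit vector fixed by]G[_l] and attains the bound. *)
Lemma sharp_opnorm n (calA : seq 'M[C]_n -> Prop) G (s : 'I_(size G) -> 'M[C]_n)
    (l : 'I_(size G)) :
  sharp_model calA s -> opnorm_is G`_l 1.
Proof.
move=> [PG sS sG _]; have [Gp _] := PG; have Hp := povm_subr l PG.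
split=> [v|c cP]; first exact: effect_vnorm.
have [sp s1] := sS l.
have fixs : G`_l *m s l = s l.
  have : s l *m (1%:M - G`_l) = 0.
    by apply: tr_mul_psd_eq0 => //; rewrite mulmxBr linearB /= mulmx1 s1 sG subrr.
  rewrite mulmxBr mulmx1 => /eqP; rewrite subr_eq0 => /eqP/(congr1 (@adj C _ _)).
  by rewrite adj_mul (psd_herm sp) (psd_herm (Gp l)).
have [j nj] : exists j, col j (s l) != 0.
  apply/existsP; apply: contraT => /existsPn c0; move/eqP: s1.
  suff -> : s l = 0 by rewrite linear0 eq_sym oner_eq0.
  apply/matrixP=> i j; have := c0 j; rewrite negbK => /eqP/colP/(_ i).
  by rewrite !mxE.
pose q := (adj (col j (s l)) *m col j (s l)) 0 0.
have q0 : 0 <= q by rewrite /q -trace_mx11 tr_gram_ge0.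
have qN : sqrtC q != 0.
  rewrite sqrtC_eq0; apply: contra nj => /eqP q1; apply/eqP/tr_gram_eq0.
  by rewrite trace_mx11.
pose v := (sqrtC q)^-1 *: col j (s l).
have Gv : G`_l *m v = v by rewrite /v -scalemxAr colE mulmxA fixs.
have v1 : vnorm v = 1.
  apply/vnorm1P; rewrite /v adjZ -scalemxAl -scalemxAr mxE [X in _ * X]mxE -/q.
  rewrite conj_Creal ?rpredV ?ger0_real ?sqrtC_ge0 //.
  by rewrite mulrA -invfM -expr2 sqrtCK mulVf // -sqrtC_eq0.
by have := cP v v1; rewrite Gv v1.
Qed.

(** If 1 is an eigenvalue, the projection on a unit eigenvector is the state. Otherwise all
    eigenvalues lie below a common bound less than 1, against the norm. *)
Lemma opnorm_state n (X : 'M[C]_n) :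
  psd X -> psd (1%:M - X) -> opnorm_is X 1 ->
  exists2 s, is_state s & \tr (s *m X) = 1.
Proof.
move=> Xp Yp [_ X1]; have [U [d [U1 U2 eqX _]]] := herm_spectral (psd_herm Xp).
have col1 i : (adj (col i U) *m col i U) 0 0 = 1.
  have U1i : (adj U *m U) i i = 1 by rewrite U1 mxE eqxx.
  by rewrite -[RHS]U1i !mxE; apply: eq_bigr => j _; rewrite !mxE.
have d0 i : 0 <= d 0 i by rewrite -(quad_diag d i U1) -eqX.
have d1 i : d 0 i <= 1.
  have := Yp (col i U); rewrite mulmxBr mulmxBl mulmx1 mxE col1 mxE subr_ge0.
  by rewrite eqX quad_diag.
case: (boolP [exists i, d 0 i == 1]) => [/existsP[i /eqP di]|/existsPn dN].
  exists (col i U *m adj (col i U)).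
    split; last by rewrite mxtrace_mulC trace_mx11.
    by rewrite -{1}[col i U]adjK; apply: psd_gram.
  by rewrite -quad_tr eqX quad_diag.
pose e i := 1 - d 0 i.
have e0 i : 0 < e i by rewrite subr_gt0 lt_neqAle dN d1.
have e1 i : e i <= 1 by rewrite gerBl.
(* An explicit bound below 1 on all eigenvalues, without taking a maximum. *)
pose c := 1 - \prod_i e i.
have e01 i : 0 <= e i <= 1 by rewrite e1 ltW.
have c0 : 0 <= c by rewrite subr_ge0 prodr_ile1.
have dc i : d 0 i <= c.
  have -> : d 0 i = 1 - e i by rewrite /e subKr.
  by rewrite lerD2l lerN2 (bigD1 i) //= ger_pMr // prodr_ile1.
suff : 1 <= c by rewrite lerBrDr gerDl lt_geF ?prodr_gt0.
apply: X1 => v /vnorm1P v1; rewrite vnorm_le // adj_mul (psd_herm Xp).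
have : psd ((c ^+ 2)%:M - X *m X).
  have -> : (c ^+ 2)%:M - X *m X = U *m diag_mx (\row_i (c ^+ 2 - d 0 i ^+ 2)) *m adj U.
    have -> : diag_mx (\row_i (c ^+ 2 - d 0 i ^+ 2)) = (c ^+ 2)%:M - diag_mx d *m diag_mx d.
      by rewrite mulmx_diag; apply/matrixP=> i j; rewrite !mxE mulrnBl expr2.
    rewrite mulmxBr mulmxBl mul_mx_scalar -scalemxAl U2 scalemx1 eqX.
    by rewrite !mulmxA -[_ *m adj U *m U]mulmxA U1 mulmx1.
  apply/psd_conjV/psd_diag => i; rewrite mxE subr_ge0 ler_pXn2r ?nnegrE //.
move=> /(_ v); rewrite mulmxBr mulmxBl mul_mx_scalar -scalemxAl mxE [X in X + _]mxE v1 mulr1.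
by rewrite mxE subr_ge0 !mulmxA.
Qed.

Lemma norm1_noncontextual n (calA : seq 'M[C]_n -> Prop) (G : seq 'M[C]_n) :
  is_povm G -> (forall l : 'I_(size G), opnorm_is G`_l 1) ->
  (forall A, calA A -> post_processing A G) -> no_contextuality_proof calA.
Proof.
move=> PG GN GA; have [Gp _] := PG.
have ex (l : 'I_(size G)) : exists sl : 'M[C]_n, is_state sl /\ \tr (sl *m G`_l) = 1.
  by have [t tS tG] := opnorm_state (Gp l) (povm_subr l PG) (GN l); exists t.
have [s sP] := fin_all_exists ex.
apply: (post_processing_noncontextual (s := s) PG _ _ GA) => l; first by have [] := sP l.
by move=> _; have [] := sP l.
Qed.

(** In dimension 0 the identity is 0, so the empty list is a POVM, and every trace is an empty sum.
    This covers the case without nonzero subspaces or default states. *)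
Lemma dim0_noncontextual (calA : seq 'M[C]_0 -> Prop) : no_contextuality_proof calA.
Proof.
exists [::], (fun _ => 0); split; last split.
- by split=> [[]|] //; rewrite big_ord0; apply/matrixP=> -[].
- by case.
by move=> A _ k rho _; rewrite big_ord0 /mxtrace big_ord0.
Qed.

End Theorem2.

Theorem theorem2 (C : numClosedFieldType) (n : nat)
    (calA : seq 'M[C]_n -> Prop)
    (hA : forall A, calA A -> is_povm A) :
  [/\ (no_contextuality_proof calA <-> broadcastable (@is_state C n) calA calA),
      (no_contextuality_proof calA <->
         exists G : seq 'M[C]_n,
           [/\ is_povm G,
               forall l : 'I_(size G), opnorm_is G`_l 1
             & forall A, calA A -> post_processing A G])
    & (no_contextuality_proof calA <->
         exists G : seq 'M[C]_n,
           [/\ is_povm G, repeatable G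
             & forall A, calA A -> post_processing A G])].
Proof.
(* All implications out of noncontextuality start from one sharp model. *)
have sharp : no_contextuality_proof calA ->
    exists G (s : 'I_(size G) -> 'M[C]_n), sharp_model calA s.
  by move=> /noncontextual_model[r [g [s /model_sharp]]].
have post G (s : 'I_(size G) -> 'M[C]_n) : sharp_model calA s ->
    forall A, calA A -> post_processing A G.
  by move=> sh A cA; apply: sharp_post_processing sh cA (hA A cA).
have n0P : n = 0%N \/ (0 < n)%N by case: (n) => [|m]; [left|right].
split; split.
- by move=> /sharp[G [s /sharp_broadcastable]].
- case: n0P => [n0|n0]; last exact: broadcastable_noncontextual.
  by move=> _; move: calA {hA sharp post}; rewrite n0; apply: dim0_noncontextual.
- move=> /sharp[G [s sh]]; exists G; split; last exact: post sh.
    by case: sh.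
  by move=> l; apply: sharp_opnorm sh.
- by move=> [G [PG GN GA]]; apply: norm1_noncontextual GA.
- move=> /sharp[G [s sh]]; exists G; split; last exact: post sh.
    by case: sh.
  exact: sharp_repeatable sh.
move=> [G [PG GR GA]]; case: n0P => [n0|n0]; last exact: repeatable_noncontextual GA.
by move: calA {hA sharp post GA}; rewrite n0; apply: dim0_noncontextual.
Qed.
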